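(* Let $R\subset S$ be an FCP extension, $\overline R$ the integral closure of $R$ in $S$ and $\widetilde R$ the Prüfer hull of $R$ in $S$. The following are equivalent: (1) $\mathrm{Supp}(\overline R/R)\cap\mathrm{Supp}(S/\overline R)=\emptyset$; (2) the map $\varphi:[R,S]\to[R,\overline R]\times[\overline R,S]$, $\varphi(T)=(T\cap\overline R,T\overline R)$, is an order-isomorphism; (3) $R\subseteq S$ is almost-Prüfer; (4) $\mathrm{Supp}(S/\overline R)=\mathrm{Supp}(\widetilde R/R)$; (5) the map $\varphi_1:[R,\widetilde R]\to[\overline R,S]$, $\varphi_1(T)=T\overline R$, is an order-isomorphism; (6) the map $\psi_1:[R,\overline R]\to[\widetilde R,S]$, $\psi_1(T)=T\widetilde R$, is an order-isomorphism; (7) the map $\theta:[R,\widetilde R]\times[R,\overline R]\to[R,S]$, $\theta(T,T')=TT'$, is an order-isomorphism. If one of these conditions holds, then $\mathrm{Supp}(S/\widetilde R)=\mathrm{Supp}(\overline R/R)$. If moreover $R\subset S$ has FIP, then (1)–(7) are also equivalent to each of: (8) $|[R,S]|=|[R,\widetilde R]|\,|[R,\overline R]|$; (9) $|[R,S]|=|[R,\overline R]|\,|[\overline R,S]|$; (10) $|[R,\widetilde R]|=|[\overline R,S]|$; (11) $|[R,\overline R]|=|[\widetilde R,S]|$.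
   Context: All rings are commutative with identity. $[A,B]$ is the set of $A$-subalgebras of $B$, ordered by inclusion; $TT'$ denotes the subring generated by $T$ and $T'$. $R\subseteq S$ has FCP if every chain in $[R,S]$ is finite, and FIP if $[R,S]$ is finite. A flat epimorphism is a flat ring morphism which is an epimorphism of commutative rings. $A\subseteq B$ is Prüfer if $A\subseteq U$ is a flat epimorphism for every $U\in[A,B]$. The Prüfer hull $\widetilde R$ is the greatest $U\in[R,S]$ with $R\subseteq U$ Prüfer. $R\subseteq S$ is almost-Prüfer if there is $T\in[R,S]$ with $R\subseteq T$ Prüfer and $T\subseteq S$ integral. Supports are over $R$: $\mathrm{Supp}(E)=\{P\in\mathrm{Spec}(R)\mid E_P\neq 0\}$. *)

(* Defs.v *)
From HB Require Import structures.
From mathcomp Require Import all_boot all_algebra.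
From mathcomp Require Import finmap boolp classical_sets cardinality.
Set Implicit Arguments.
Unset Strict Implicit.
Unset Printing Implicit Defensive.
Import GRing.Theory.
Local Open Scope ring_scope.
Local Open Scope classical_set_scope.

(* Throughout, all rings in play are subrings of an ambient commutative ring A.
   A ring extension R ⊆ S is modelled by two subrings R ⊆ S of A, and an
   element of [R,S] is a subring T of A with R ⊆ T ⊆ S.                      *)

Section RingExt.
Variable A : comPzRingType.

Definition subring (T : set A) : Prop :=
  T 1 /\ (forall x y, T x -> T y -> T (x - y)) /\
  (forall x y, T x -> T y -> T (x * y)).

Definition ivl (R S : set A) : set (set A) :=
  [set T | subring T /\ R `<=` T /\ T `<=` S].

Definition compositum (T T' : set A) : set A :=
  [set x | forall V, subring V -> T `<=` V -> T' `<=` V -> V x].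

Definition chain (C : set (set A)) : Prop :=
  forall T U, C T -> C U -> T `<=` U \/ U `<=` T.

Definition FCP (R S : set A) : Prop :=
  forall C, C `<=` ivl R S -> chain C -> finite_set C.

Definition FIP (R S : set A) : Prop := finite_set (ivl R S).

Definition integral_over (T : set A) (x : A) : Prop :=
  exists n (c : 'I_n -> A), (forall i, T (c i)) /\
    x ^+ n + \sum_(i < n) c i * x ^+ i = 0.

Definition integral_ext (T S : set A) : Prop :=
  forall x, S x -> integral_over T x.

Definition intclos (R S : set A) : set A := [set x | S x /\ integral_over R x].

Definition ring_hom_on (C : comPzRingType) (U : set A) (f : A -> C) : Prop :=
  f 1 = 1 /\ forall x y, U x -> U y ->
    f (x + y) = f x + f y /\ f (x * y) = f x * f y.

Definition epimorphism (R U : set A) : Prop :=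
  forall (C : comPzRingType) (f g : A -> C),
    ring_hom_on U f -> ring_hom_on U g ->
    (forall r, R r -> f r = g r) -> forall u, U u -> f u = g u.

(* U is a flat R-module (equational criterion of flatness). *)
Definition flat (R U : set A) : Prop :=
  forall n (r u : 'I_n -> A), (forall i, R (r i)) -> (forall i, U (u i)) ->
    \sum_(i < n) r i * u i = 0 ->
    exists m (a : 'I_n -> 'I_m -> A) (v : 'I_m -> A),
      [/\ forall i j, R (a i j), forall j, U (v j),
          forall i, u i = \sum_(j < m) a i j * v j &
          forall j, \sum_(i < n) r i * a i j = 0].

Definition flat_epi (R U : set A) : Prop := flat R U /\ epimorphism R U.

Definition prufer (R B : set A) : Prop :=
  forall U, ivl R B U -> flat_epi R U.

Definition prufer_hull (R S H : set A) : Prop :=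
  [/\ ivl R S H, prufer R H &
      forall U, ivl R S U -> prufer R U -> U `<=` H].

Definition almost_prufer (R S : set A) : Prop :=
  exists T, [/\ ivl R S T, prufer R T & integral_ext T S].

Definition prime_of (R P : set A) : Prop :=
  [/\ P `<=` R, P 0, (forall x y, P x -> P y -> P (x - y)) &
      (forall r x, R r -> P x -> P (r * x))] /\
  (~ P 1 /\ (forall x y, R x -> R y -> P (x * y) -> P x \/ P y)).

(* Supp_R(E/B) for R-submodules B ⊆ E of A:  (E/B)_P <> 0 iff some class
   [e] is not killed by any s ∈ R \ P. *)
Definition Supp (R E B : set A) : set (set A) :=
  [set P | prime_of R P /\
           exists e, E e /\ forall s, R s -> ~ P s -> ~ B (s * e)].

End RingExt.

Definition order_iso (X Y : Type) (DX : set X) (DY : set Y)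
  (leX : X -> X -> Prop) (leY : Y -> Y -> Prop) (f : X -> Y) : Prop :=
  [/\ forall x, DX x -> DY (f x),
      (forall y, DY y -> exists2 x, DX x & f x = y) &
      forall x x', DX x -> DX x' -> (leX x x' <-> leY (f x) (f x'))].

Definition pair_le (A : Type) (p q : set A * set A) : Prop :=
  p.1 `<=` q.1 /\ p.2 `<=` q.2.

Definition ncard (X : choiceType) (D : set X) : nat := #|` fset_set D|%fset.

(* Main.v *)
Require Import Defs.
From HB Require Import structures.
From mathcomp Require Import all_boot all_algebra.
From mathcomp Require Import finmap boolp classical_sets cardinality.
From mathcomp Require Import ring zify.
Set Implicit Arguments.
Unset Strict Implicit.
Unset Printing Implicit Defensive.
Import GRing.Theory.
Local Open Scope ring_scope.
Local Open Scope classical_set_scope.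

(** Write B for the integral closure of R in S and J for the conductor (R : B).

    Over an FCP extension R <= T, Prüfer means integrally closed. If R is
    integrally closed in T, stationarity of R[v^(2^k)] makes v a root of a
    polynomial over R with a coefficient 1, and folding leading coefficients
    shows that the conductor of v generates the unit ideal, which is the
    criterion for flat epimorphisms. Conversely a finite epimorphism is onto,
    by comparing the two maps from R[u] to a quotient of R[u][X].

    B is a finite R-module, so disjointness of the supports says that for every
    v in S some a in J has (1 - a) v in B. Then T is recovered from its images
    as (T cap B) + J (T B), which gives the product decomposition of [R, S].
    If T is Prüfer over R and S is integral over T, or generated by T and B,
    this comaximality holds: with I the conductor of v in T, the rings
    R + I^k B become stationary and Nakayama's lemma gives an element of I
    congruent to 1 modulo J.

    Hence everything holds for R in the compositum S' of the Prüfer hull and B,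
    and each of the conditions forces S = S'. *)

(** * Subrings, submodules, Nakayama's lemma, monotone sequences and maximal ideals *)

Section Modules.
Variable A : comPzRingType.
Implicit Types (R S T U V E I X Y : set A) (x y : A).

Lemma subring1 T : subring T -> T 1.
Proof. by case. Qed.
Lemma subringB T x y : subring T -> T x -> T y -> T (x - y).
Proof. by case=> _ [+ _]; apply. Qed.
Lemma subringM T x y : subring T -> T x -> T y -> T (x * y).
Proof. by case=> _ [_ +]; apply. Qed.
Lemma subring0 T : subring T -> T 0.
Proof. by move=> hT; have T1 := subring1 hT; rewrite -(subrr 1); apply: subringB. Qed.
Lemma subringN T x : subring T -> T x -> T (- x).
Proof. by move=> hT Tx; rewrite -sub0r; apply: subringB => //; apply: subring0. Qed.
Lemma subringD T x y : subring T -> T x -> T y -> T (x + y).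
Proof. by move=> hT Tx Ty; rewrite -[y]opprK; apply: subringB => //; apply: subringN. Qed.
Lemma subringX T x n : subring T -> T x -> T (x ^+ n).
Proof.
move=> hT Tx; elim: n => [|n IH]; first by rewrite expr0; apply: subring1.
by rewrite exprS; apply: subringM.
Qed.
Lemma subring_sum T (J : Type) (r : seq J) (P : pred J) (F : J -> A) :
  subring T -> (forall i, P i -> T (F i)) -> T (\sum_(i <- r | P i) F i).
Proof.
move=> hT hF; apply: (big_ind T) => //; first exact: subring0.
by move=> x y; apply: subringD.
Qed.

Lemma subringI T U : subring T -> subring U -> subring (T `&` U).
Proof.
move=> hT hU; split; first by split; apply: subring1.
by split=> x y [Tx Ux] [Ty Uy]; split; (exact: subringB || exact: subringM).
Qed.

Lemma compositum_subring T U : subring (compositum T U).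
Proof.
split; first by move=> V hV _ _; apply: subring1.
split=> x y hx hy V hV TV UV.
  by apply: subringB => //; [apply: hx | apply: hy].
by apply: subringM => //; [apply: hx | apply: hy].
Qed.

Lemma compositum_subl T U : T `<=` compositum T U.
Proof. by move=> x Tx V _ TV _; apply: TV. Qed.
Lemma compositum_subr T U : U `<=` compositum T U.
Proof. by move=> x Ux V _ _; apply. Qed.
Lemma compositum_min T U V :
  subring V -> T `<=` V -> U `<=` V -> compositum T U `<=` V.
Proof. by move=> hV TV UV x; apply. Qed.
Lemma compositumS T U T' U' :
  T `<=` T' -> U `<=` U' -> compositum T U `<=` compositum T' U'.
Proof.
move=> TT UU; apply: compositum_min; first exact: compositum_subring.
  exact: subset_trans TT (@compositum_subl _ _).
exact: subset_trans UU (@compositum_subr _ _).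
Qed.

(** Submodules of the ambient ring; an ideal of [R] is an [R]-submodule that lies in [R]. *)
Definition submod U E : Prop :=
  [/\ E 0, forall x y, E x -> E y -> E (x - y) & forall r x, U r -> E x -> E (r * x)].

Lemma submodD U E x y : submod U E -> E x -> E y -> E (x + y).
Proof.
move=> [h0 hB _] Ex Ey; rewrite -[y]opprK; apply: (hB) => //.
by rewrite -sub0r; apply: hB.
Qed.

Lemma submod_sum U E (J : Type) (r : seq J) (P : pred J) (F : J -> A) :
  submod U E -> (forall i, P i -> E (F i)) -> E (\sum_(i <- r | P i) F i).
Proof.
move=> hE hF; apply: (big_ind E) => //; first by case: hE.
by move=> x y; apply: submodD hE.
Qed.

Lemma submod_subring R T : subring T -> R `<=` T -> submod R T.
Proof.
move=> hT RT; split; [exact: subring0 | by move=> *; apply: subringB |].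
by move=> r x /RT Tr Tx; apply: subringM.
Qed.

Lemma submodS U V E : U `<=` V -> submod V E -> submod U E.
Proof. by move=> UV [h0 hB hZ]; split=> // r x /UV; apply: hZ. Qed.

(** Encoded as an intersection, so that [mspan_min] is an induction principle: to prove a property
    on the whole span, take for [E] the set of elements that have it. *)
Definition mspan U X : set A :=
  [set x | forall E, submod U E -> X `<=` E -> E x].

Lemma mspan_submod U X : submod U (mspan U X).
Proof.
split=> [E [] //|x y hx hy E hE XE|r x Ur hx E hE XE]; have [h0 hB hZ] := hE.
  by apply: hB; [apply: hx | apply: hy].
by apply: hZ => //; apply: hx.
Qed.

Lemma mspan_sub U X : X `<=` mspan U X.
Proof. by move=> x Xx E _; apply. Qed.

Lemma mspan_min U X E : submod U E -> X `<=` E -> mspan U X `<=` E.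
Proof. by move=> hE XE x; apply. Qed.

Lemma mspanS U X Y : X `<=` Y -> mspan U X `<=` mspan U Y.
Proof.
move=> XY; apply: mspan_min; first exact: mspan_submod.
exact: subset_trans XY (@mspan_sub _ _).
Qed.

Lemma submod_preim U E (c : A) : submod U E -> submod U [set x | E (c * x)].
Proof.
move=> [h0 hB hZ]; split=> /=; first by rewrite mulr0.
  by move=> x y Ex Ey; rewrite mulrBr; apply: hB.
by move=> r x Ur Ex; rewrite mulrCA; apply: hZ.
Qed.


(** Supplies the coefficients from which factorizations for the flatness criterion and powers of
    conductors are built. *)
Lemma mspan_sum U X x : subring U -> mspan U X x ->
  exists n (a v : 'I_n -> A), [/\ forall j, U (a j), forall j, X (v j) &
    x = \sum_(j < n) a j * v j].
Proof.
move=> hU hx.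
(* With lists of pairs instead of indexed families, a difference of two combinations is a
   concatenation. *)
suff [s sP ->] : exists2 s : seq (A * A),
    (forall p, p \in s -> U p.1 /\ X p.2) & x = \sum_(p <- s) p.1 * p.2.
  exists (size s), (fun j => (tnth (in_tuple s) j).1),
    (fun j => (tnth (in_tuple s) j).2); split=> [j|j|].
  - by have [] := sP _ (mem_tnth j (in_tuple s)).
  - by have [] := sP _ (mem_tnth j (in_tuple s)).
  - by rewrite big_tnth.
move: x hx; apply: mspan_min; last first.
  move=> x Xx; exists [:: (1, x)]; last by rewrite big_seq1 mul1r.
  by move=> p; rewrite inE => /eqP ->; split=> //; apply: subring1.
split=> /=.
- by exists [::]; rewrite ?big_nil.
- move=> x y [s sP ->] [t tP ->].
  exists (s ++ [seq (- p.1, p.2) | p <- t]).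
    move=> p; rewrite mem_cat => /orP[/sP //|/mapP[q /tP[Uq Xq] ->]].
    by split=> //; apply: subringN.
  rewrite big_cat big_map /=; congr (_ + _); rewrite -sumrN.
  by apply: eq_bigr => p _; rewrite mulNr.
- move=> r x Ur [s sP ->]; exists [seq (r * p.1, p.2) | p <- s].
    move=> p /mapP[q /sP[Uq Xq] ->]; split=> //; exact: subringM.
  by rewrite big_map mulr_sumr; apply: eq_bigr => p _; rewrite mulrA.
Qed.

Lemma mspan_subring U X : subring U -> X 1 ->
  (forall x y, X x -> X y -> X (x * y)) -> subring (mspan U X).
Proof.
move=> hU X1 XM; have hE := mspan_submod U X; have [h0 hB hZ] := hE.
split; first exact: mspan_sub.
split=> // x y hx hy; move: x hx; apply: mspan_min.
  by have := submod_preim y hE; under eq_set do rewrite mulrC.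
move=> x Xx /=; move: y hy; apply: mspan_min; first exact: submod_preim.
by move=> y Xy; apply: mspan_sub; exact: XM.
Qed.

(** Products of elements of [U] stay in [U], so the [T]-span of [U] is already a ring. *)
Lemma compositum_mspan T U : subring T -> subring U ->
  compositum T U `<=` mspan T U.
Proof.
move=> hT hU; apply: compositum_min; last exact: mspan_sub.
  by apply: mspan_subring => //; [exact: subring1 | move=> *; exact: subringM].
move=> x Tx; rewrite -[x]mulr1; case: (mspan_submod T U) => _ _; apply => //.
by apply: mspan_sub; apply: subring1.
Qed.

(** Nakayama's lemma for E/B, by induction on the generators instead of determinants. Adding a
    generator e to B gives a in I with (1 - a) E inside B + R e. Multiplying E = B + I E by 1 - a
    gives (1 - a) e = b + c e with c in I, so 1 - a - c sends e into B, and (1 - a - c)(1 - a) sends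
    E into B. *)
Lemma nakayama R I E (s : seq A) B : subring R -> submod R I -> I `<=` R ->
  submod R E -> submod R B -> B `<=` E -> [set` s] `<=` E ->
  E `<=` mspan R (B `|` [set` s]) ->
  E `<=` mspan R (B `|` [set y | exists a x, [/\ I a, E x & y = a * x]]) ->
  exists2 a, I a & forall x, E x -> B ((1 - a) * x).
Proof.
move=> hR hI IR hE; elim: s B => [|e s IHs] B hB BE sE Es EI.
  exists 0; first by case: hI.
  move=> x /Es; rewrite subr0 mul1r; apply: (mspan_min hB) => y [//|].
  by rewrite /= in_nil.
have Ee : E e by apply: sE; rewrite /= mem_head.
set B' := mspan R (B `|` [set e]).
have B'E x : B' x -> exists b r, [/\ B b, R r & x = b + r * e].
  apply: (@mspan_min R _ [set x | exists b r, [/\ B b, R r & x = b + r * e]])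
    => [|y [By|->]].
  - have [B0 BB BZ] := hB; split.
    + by exists 0, 0; split=> //; [exact: subring0 | rewrite mul0r addr0].
    + move=> _ _ [b [r [Bb Rr ->]]] [b' [r' [Bb' Rr' ->]]].
      exists (b - b'), (r - r'); split; [exact: BB|exact: subringB|ring].
    + move=> c _ Rc [b [r [Bb Rr ->]]].
      exists (c * b), (c * r); split; [exact: BZ|exact: subringM|ring].
  - by exists y, 0; split=> //; [exact: subring0 | rewrite mul0r addr0].
  - by exists 0, 1; split; [case: hB|exact: subring1 | rewrite mul1r add0r].
have BB' : B `<=` B' by move=> y By; apply: mspan_sub; left.
have [|||||a Ia aE] := IHs B'.
- exact: mspan_submod.
- by apply: mspan_min => // y [/BE|->].
- by move=> y /= sy; apply: sE; rewrite /= in_cons sy orbT.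
- move=> x /Es; apply: mspan_min; first exact: mspan_submod.
  move=> y [/BB' By|/=]; first by apply: mspan_sub; left.
  rewrite in_cons => /orP[/eqP ->|ys]; last by apply: mspan_sub; right.
  by apply: mspan_sub; left; apply: mspan_sub; right.
- move=> x /EI; apply: mspanS => y [/BB'|]; [by left | by right].
have R1a : R (1 - a) by apply: subringB => //; [exact: subring1 | exact: IR].
have [B0 BB BZ] := hB; have [I0 IB IZ] := hI.
have [b [c [Bb Ic ec]]] : exists b c, [/\ B b, I c & (1 - a) * e = b + c * e].
  suff: forall x, E x -> exists b c, [/\ B b, I c & (1 - a) * x = b + c * e].
    exact.
  move=> x /EI; move: x.
  apply: (@mspan_min R _ [set x | exists b c, [/\ B b, I c & (1 - a) * x = b + c * e]])
    => [|x [Bx|[d [y [Id Ey ->]]]]].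
  - split.
    + by exists 0, 0; split=> //; ring.
    + move=> x y [b [r [Bb Ir ex]]] [b' [r' [Bb' Ir' ey]]].
      exists (b - b'), (r - r'); split; [exact: BB|exact: IB|].
      rewrite mulrBr ex ey; ring.
    + move=> d x Rd [b [r [Bb Ir ex]]].
      exists (d * b), (d * r); split; [exact: BZ|exact: IZ|].
      rewrite mulrCA ex; ring.
  - by exists ((1 - a) * x), 0; split=> //; [exact: BZ | ring].
  - have /B'E[b [r [Bb Rr ey]]] := aE _ Ey.
    exists (d * b), (r * d); split; [exact/BZ/Bb/IR | exact: IZ |].
    rewrite mulrCA ey; ring.
exists (1 - (1 - a - c) * (1 - a)).
  have -> : 1 - (1 - a - c) * (1 - a) = a + (1 - a) * (a + c) by ring.
  by apply: (submodD hI) => //; apply: (IZ) => //; apply: (submodD hI).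
move=> x Ex; have /B'E[b' [r [Bb' Rr ex]]] := aE _ Ex.
have -> : (1 - (1 - (1 - a - c) * (1 - a))) * x
        = (1 - a - c) * b' + r * b.
  have -> : b = (1 - a) * e - c * e by rewrite ec; ring.
  transitivity ((1 - a - c) * ((1 - a) * x)); first by ring.
  rewrite ex; ring.
apply: (submodD hB); apply: BZ => //.
by apply: subringB => //; apply: IR.
Qed.

Lemma FCP_sub R S R' S' : R `<=` R' -> S' `<=` S -> FCP R S -> FCP R' S'.
Proof.
move=> RR SS h C hC; apply: h => T /hC[hT [RT TS]].
by split=> //; split; [exact: subset_trans RT | exact: subset_trans SS].
Qed.

(** The range of a monotone sequence is a chain, hence finite. One repetition is enough: by
    monotonicity the sequence is constant between the two indices. *)
Lemma FCP_seq R S (T : nat -> set A) : FCP R S ->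
  (forall k, ivl R S (T k)) ->
  (forall k, T k `<=` T k.+1) \/ (forall k, T k.+1 `<=` T k) ->
  exists i j, (i < j)%N /\ T i = T j.
Proof.
move=> hF hT mono.
have le i j : (i <= j)%N -> (forall k, T k `<=` T k.+1) -> T i `<=` T j.
  move=> + h; elim: j => [|j IH]; first by rewrite leqn0 => /eqP ->.
  rewrite leq_eqVlt => /orP[/eqP -> //|/IH/subset_trans]; exact.
have ge i j : (i <= j)%N -> (forall k, T k.+1 `<=` T k) -> T j `<=` T i.
  move=> + h; elim: j => [|j IH]; first by rewrite leqn0 => /eqP ->.
  rewrite leq_eqVlt => /orP[/eqP -> //|/IH]; exact: subset_trans.
have fin : finite_set (range T).
  apply: hF => [_ [k _ <-] //|_ _ [i _ <-] [j _ <-]].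
  have [ij|/ltnW ji] := leqP i j; case: mono => h;
    [left; exact: le|right; exact: ge|right; exact: le|left; exact: ge].
apply: contrapT => hn; apply: infinite_nat.
suff inj : {in [set: nat] &, injective T} by rewrite -(eq_finite_set (inj_card_eq inj)).
move=> i j _ _ Tij; apply: contrapT => /eqP; rewrite neq_ltn => /orP[ij|ji]; apply: hn.
  by exists i, j.
by exists j, i.
Qed.

(** The last two clauses say that R/M is a field, the form in which maximality is used. *)
Definition maximal_ideal R M : Prop :=
  [/\ submod R M, M `<=` R, ~ M 1 &
      forall c, R c -> ~ M c -> exists2 d, R d & M (1 - d * c)].

Lemma maximal_ideal_prime R M : subring R -> maximal_ideal R M -> prime_of R M.
Proof.
move=> hR [[M0 MB MZ] MR M1 Mm]; split; first by split.
split=> // x y Rx Ry Mxy; have [?|Mx] := pselect (M x); first by left.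
right; have [d Rd Md] := Mm _ Rx Mx.
have -> : y = y * (1 - d * x) - (- d) * (x * y) by ring.
by apply: MB; apply: MZ => //; apply: subringN.
Qed.

(** Zorn's lemma is applied to the subsets X of R such that I and X together do not generate 1; the
    maximal ideal is the span of I and a maximal such X. *)
Lemma ex_maximal_ideal R I : subring R -> submod R I -> I `<=` R -> ~ I 1 ->
  exists2 M, maximal_ideal R M & I `<=` M.
Proof.
move=> hR hI IR I1.
pose P X := X `<=` R /\ ~ mspan R (I `|` X) 1.
have [X [[XR X1] Xmax]] : exists X, P X /\ forall Y, X `<` Y -> ~ P Y.
  apply: Zorn_bigcup => F FP Ftot; split.
    by move=> x [X FX Xx]; have [XR _] := FP _ FX; apply: XR.
  (* The empty chain is treated apart: its union is empty, and the span is I itself. *)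
  have [[X0 FX0]|F0] := pselect (exists X, F X); last first.
    apply: contra_not I1; apply: mspan_min => // x [//|[X FX _]].
    by exfalso; apply: F0; exists X.
  pose E := \bigcup_(X in F) mspan R (I `|` X).
  have hE : submod R E.
    split.
    - by exists X0 => //; case: (mspan_submod R (I `|` X0)).
    - move=> x y [X FX hx] [Y FY hy].
      wlog XY : x y X Y FX FY hx hy / X `<=` Y.
        move=> W; have [XY|YX] := Ftot _ _ FX FY; first exact: W hx hy XY.
        have [Z FZ hZ] := W _ _ _ _ FY FX hy hx YX.
        exists Z => //; rewrite -opprB -mulN1r.
        case: (mspan_submod R (I `|` Z)) => _ _; apply => //.
        by apply: subringN => //; apply: subring1.
      exists Y => //; case: (mspan_submod R (I `|` Y)) => _ hB _.
      by apply: hB => //; move: hx; apply: mspanS; apply: setUS.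
    - move=> r x Rr [X FX hx]; exists X => //.
      by case: (mspan_submod R (I `|` X)) => _ _; apply.
  move=> h; have [|X FX hX] := h E hE; last by have [_] := FP _ FX; apply.
  move=> x [Ix|[X FX Xx]]; first by exists X0 => //; apply: mspan_sub; left.
  by exists X => //; apply: mspan_sub; right.
exists (mspan R (I `|` X)); last by move=> x Ix; apply: mspan_sub; left.
split=> //; [exact: mspan_submod | |].
  apply: mspan_min; first exact: submod_subring.
  by move=> x [/IR|/XR].
move=> c Rc Mc; set M := mspan _ _ in Mc X1 *.
have [M0 MB MZ] : submod R M by exact: mspan_submod.
have /not_andP[] : ~ P (X `|` [set c]).
- apply: Xmax; split; first by left.
  by move=> h; apply: Mc; apply: mspan_sub; right; apply: h; right.
- by move=> []; move=> x [/XR|->].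
move=> /contrapT h; suff [d [Rd Md]] : exists d, R d /\ M (1 - d * c) by exists d.
move: h; apply: (@mspan_min R _ [set x | exists d, R d /\ M (x - d * c)]).
  split.
  - by exists 0; split; [exact: subring0 | rewrite mul0r subr0].
  - move=> x y [d [Rd Md]] [e [Re Me]]; exists (d - e); split; first exact: subringB.
    have -> : x - y - (d - e) * c = (x - d * c) - (y - e * c) by ring.
    exact: MB.
  - move=> r x Rr [d [Rd Md]]; exists (r * d); split; first exact: subringM.
    have -> : r * x - r * d * c = r * (x - d * c) by ring.
    exact: MZ.
have MU x : (I `|` X) x -> exists d, R d /\ M (x - d * c).
  move=> h; exists 0; split; first exact: subring0.
  by rewrite mul0r subr0; apply: mspan_sub.
move=> x [Ix|[Xx|->]]; [by apply: MU; left | by apply: MU; right |].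
by exists 1; split; [exact: subring1 | rewrite mul1r subrr].
Qed.

End Modules.

(** * Integrality over a subring, through the ring structure on its subtype *)

Section SubringType.
Variables (A : comNzRingType) (T : set A) (hT : subring T).

(** The proof of [subring T] is carried as a dummy argument, so that the closure instance below can
    be attached to the predicate. *)
Definition subring_pred (_ : subring T) : {pred A} := fun x => `[< T x >].
Local Notation Tp := (subring_pred hT).

Lemma subring_predP : subring_closed Tp.
Proof.
split=> [|x y /asboolP ? /asboolP ?|x y /asboolP ? /asboolP ?]; apply/asboolP.
- exact: subring1.
- exact: subringB.
- exact: subringM.
Qed.

HB.instance Definition _ := GRing.isSubringClosed.Build A Tp subring_predP.

Record subring_type := SubringType { subring_val :> A; _ : subring_val \in Tp }.
HB.instance Definition _ := [isSub for subring_val].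
HB.instance Definition _ := [Choice of subring_type by <:].
HB.instance Definition _ := [SubChoice_isSubComNzRing of subring_type by <:].

Lemma subring_valP (x : subring_type) : T (val x).
Proof. exact/asboolP/(valP x). Qed.

Lemma subring_valK x : T x -> exists y : subring_type, val y = x.
Proof. by move=> /asboolP Tx; exists (SubringType Tx). Qed.

Let coef_val (p : {poly subring_type}) i :
  (map_poly (val : subring_type -> A) p)`_i = val p`_i.
Proof. exact: coef_map. Qed.

Let val1 : val (1 : subring_type) = 1.
Proof. exact: rmorph1. Qed.

Let size_val (p : {poly subring_type}) :
  (size (map_poly (val : subring_type -> A) p) <= size p)%N.
Proof. by apply/leq_sizeP => i h; rewrite coef_val nth_default ?raddf0. Qed.

Lemma integral_overP x : integral_over T x <-> integralOver (val : subring_type -> A) x.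
Proof.
split.
  move=> [n [c [cT cx]]].
  have /choice[d dE] i : exists y : subring_type, val y = c i by exact: subring_valK.
  (* [insub] converts the natural index into an ordinal; its default 0 is never reached below
     [n]. *)
  pose p := 'X^n + \poly_(i < n) (if insub i is Some j then d j else 0).
  have sp : size p = n.+1.
    by rewrite size_polyDl size_polyXn // ltnS size_poly.
  have pn : p`_n = 1 by rewrite coefD coefXn eqxx coef_poly ltnn addr0.
  exists p; first by rewrite monicE /lead_coef sp pn.
  apply/rootP; rewrite (horner_coef_wide x (n := n.+1)); last by rewrite -sp.
  rewrite big_ord_recr /= coef_val pn val1 mul1r addrC -[RHS]cx; congr (_ + _).
  apply: eq_bigr => i _; rewrite coef_val coefD coefXn coef_poly ltn_ord.
  by rewrite (ltn_eqF (ltn_ord i)) add0r valK /= dE.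
move=> [p mp /rootP px].
exists (size p).-1, (fun i => val p`_i); split=> [i|]; first exact: subring_valP.
rewrite -[RHS]px (horner_coef_wide x (n := (size p).-1.+1)); last first.
  exact: leq_trans (size_val _) (leqSpred _).
rewrite big_ord_recr /= addrC; congr (_ + _).
  by rewrite coef_val -[p`__]/(lead_coef p) (monicP mp) val1 mul1r.
by apply: eq_bigr => i _; rewrite coef_val.
Qed.

Lemma integral_overB x y :
  integral_over T x -> integral_over T y -> integral_over T (x - y).
Proof. by move=> /integral_overP ? /integral_overP ?; apply/integral_overP/integral_sub. Qed.

Lemma integral_overM x y :
  integral_over T x -> integral_over T y -> integral_over T (x * y).
Proof. by move=> /integral_overP ? /integral_overP ?; apply/integral_overP/integral_mul. Qed.

Lemma integral_over_id x : T x -> integral_over T x.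
Proof. by move=> /subring_valK[y <-]; apply/integral_overP/integral_id. Qed.

Lemma integral_over_trans (U : set A) x :
  integral_ext T U -> integral_over U x -> integral_over T x.
Proof.
move=> TU [n [c [cU cx]]]; apply/integral_overP.
pose p := 'X^n + \poly_(i < n) (if insub i is Some j then c j else 0).
apply: (@integral_root_monic _ _ _ _ p).
- rewrite monicE lead_coefDl ?lead_coefXn //.
  by rewrite size_polyXn ltnS size_poly.
- apply/rootP; rewrite !hornerE horner_poly -[RHS]cx; congr (_ + _).
  by apply: eq_bigr => i _; rewrite /= valK.
apply/integral_poly => i; rewrite coefD coefXn coef_poly.
apply: integral_add; first exact: integral_nat.
case: ifP => [lt|_]; last exact: integral0.
by rewrite insubT //; apply/integral_overP/TU.
Qed.

End SubringType.

(** * The quotient of a subring by a proper ideal *)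

Section IdealQuotient.
Variables (A : comNzRingType) (T I : set A) (hT : subring T).
Hypotheses (hI : submod T I) (I1 : ~ I 1).

Definition ideal_pred (_ : submod T I) (_ : ~ I 1) : {pred subring_type hT} :=
  fun x => `[< I (val x) >].
Local Notation Ip := (ideal_pred hI I1).

Lemma ideal_predP : idealr_closed Ip.
Proof.
have [I0 IB IZ] := hI; split.
- by apply/asboolP; rewrite rmorph0.
- by apply/negP => /asboolP; rewrite rmorph1.
- move=> a x y /asboolP Ix /asboolP Iy; apply/asboolP.
  rewrite rmorphD rmorphM /=; apply: (submodD hI) => //.
  by apply: IZ => //; apply: subring_valP.
Qed.

HB.instance Definition _ := isIdealr.Build _ Ip ideal_predP.

(** The quotient map is a function on all of [A] that is a morphism on [T], the kind of map over
    which [epimorphism] quantifies. *)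
Lemma ideal_quotient : exists (C : comPzRingType) (f : A -> C),
  ring_hom_on T f /\ forall x y, T x -> T y -> (f x = f y <-> I (x - y)).
Proof.
(* Elements outside [T] are sent to 0, an arbitrary value. *)
pose g (x : A) : subring_type hT := insubd 0 x.
have gK x : T x -> val (g x) = x.
  by move=> /asboolP Tx; rewrite /g val_insubd; case: ifP => //; rewrite [_ \in _]Tx.
have gD x y : T x -> T y -> g (x + y) = g x + g y.
  by move=> Tx Ty; apply: val_inj; rewrite rmorphD /= !gK //; apply: subringD.
have gM x y : T x -> T y -> g (x * y) = g x * g y.
  by move=> Tx Ty; apply: val_inj; rewrite rmorphM /= !gK //; apply: subringM.
exists {ideal_quot Ip}, (fun x => \pi_({ideal_quot Ip})%qT (g x)).
split.
  split.
    have -> : g 1 = 1 by apply: val_inj; rewrite gK ?rmorph1 //; apply: subring1.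
    by rewrite rmorph1.
  by move=> x y Tx Ty; rewrite gD // gM // rmorphD rmorphM.
move=> x y Tx Ty; split.
  move=> /eqP; rewrite -Quotient.idealrBE => /asboolP.
  by rewrite rmorphB /= !gK.
move=> h; apply/eqP; rewrite -Quotient.idealrBE; apply/asboolP.
by rewrite rmorphB /= !gK.
Qed.

End IdealQuotient.

(** * Adjoining one element: finiteness, integrality and conductors *)

Section Adjoin.
Variable A : comNzRingType.
Implicit Types (R S T U V E I N : set A) (x y u v w : A) (p q : {poly A}).

Definition coefs_in T p := forall i, T p`_i.

(** T[X] becomes a subring of the ring of polynomials over the ambient ring, so the results on
    subrings and quotients apply to it. *)
Lemma coefs_in_subring T : subring T -> subring (coefs_in T : set {poly A}).
Proof.
move=> hT; split=> [i|].
  by rewrite coef1; case: eqP => _; [exact: subring1 | exact: subring0].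
split=> p q hp hq i; first by rewrite coefB; apply: subringB.
by rewrite coefM; apply: subring_sum => // j _; apply: subringM.
Qed.

Lemma coefs_inC T x : subring T -> T x -> coefs_in T x%:P.
Proof. by move=> hT Tx i; rewrite coefC; case: eqP => // _; apply: subring0. Qed.

Lemma coefs_inXn T n : subring T -> coefs_in T 'X^n.
Proof.
by move=> hT i; rewrite coefXn; case: eqP => _; [exact: subring1 | exact: subring0].
Qed.

Lemma coefs_inX T : subring T -> coefs_in T 'X.
Proof. exact: (@coefs_inXn T 1). Qed.

Lemma horner_coefs_in T p x : subring T -> coefs_in T p -> T x -> T p.[x].
Proof.
move=> hT hp Tx; rewrite horner_coef; apply: subring_sum => // i _.
by apply: subringM => //; apply: subringX.
Qed.

Definition adjoin T u : set A := [set x | exists2 p, coefs_in T p & x = p.[u]].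

Lemma adjoin_subring T u : subring T -> subring (adjoin T u).
Proof.
move=> hT; have hP := coefs_in_subring hT; split.
  by exists 1; [exact: (subring1 hP) | rewrite hornerE].
split=> _ _ [p hp ->] [q hq ->].
  by exists (p - q); [exact: (subringB hP) | rewrite !hornerE].
by exists (p * q); [exact: (subringM hP) | rewrite hornerM].
Qed.

Lemma adjoin_sub T u : subring T -> T `<=` adjoin T u.
Proof. by move=> hT x Tx; exists x%:P; [exact: coefs_inC | rewrite hornerE]. Qed.

Lemma adjoin_gen T u : subring T -> adjoin T u u.
Proof. by move=> hT; exists 'X; [exact: coefs_inX | rewrite hornerE]. Qed.

Lemma adjoin_min T u V : subring V -> T `<=` V -> V u -> adjoin T u `<=` V.
Proof.
move=> hV TV Vu _ [p hp ->]; apply: horner_coefs_in => // i; exact: TV.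
Qed.

(** The monic relation expresses u^m, for m >= n, through lower powers, so the products x u^i with x
    in s and i < n generate T[u]. *)
Lemma adjoin_mspan_powers R (s : seq A) u n (c : 'I_n -> A) T : subring R -> subring T ->
  R `<=` T -> [set` s] `<=` T -> T `<=` mspan R [set` s] ->
  (forall i, T (c i)) -> u ^+ n + \sum_(i < n) c i * u ^+ i = 0 ->
  exists2 s' : seq A, [set` s'] `<=` adjoin T u & adjoin T u `<=` mspan R [set` s'].
Proof.
move=> hR hT RT sT Ts cT cu; have hTu := adjoin_subring u hT.
pose s' := [seq x * u ^+ i | x <- s, i <- iota 0 n].
exists s'.
  move=> _ /allpairsP[[x i] /= [xs _ ->]]; apply: subringM => //.
    by apply: adjoin_sub => //; apply: sT.
  by apply: subringX => //; apply: adjoin_gen.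
set E := mspan R _; have hE : submod R E by exact: mspan_submod.
have TuE t i : T t -> (i < n)%N -> E (t * u ^+ i).
  move=> /Ts + lt; move: t.
  apply: (@mspan_min _ _ _ [set t | E (t * u ^+ i)]).
    by have := submod_preim (u ^+ i) hE; under eq_set do rewrite mulrC.
  move=> x /= xs; apply: mspan_sub => /=; apply/allpairsP; exists (x, i).
  by split=> //; rewrite mem_iota.
have uE m : forall t, T t -> E (t * u ^+ m).
  elim/ltn_ind: m => m IH t Tt; have [lt|le] := ltnP m n; first exact: TuE.
  have -> : u ^+ m = - (\sum_(i < n) c i * u ^+ (i + (m - n))).
    rewrite -{1}(subnKC le) exprD.
    have -> : u ^+ n = - (\sum_(i < n) c i * u ^+ i).
      by apply/eqP; rewrite -addr_eq0 cu.
    by rewrite mulNr mulr_suml; congr (- _); apply: eq_bigr => i _; rewrite exprD mulrA.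
  rewrite mulrN -mulNr mulr_sumr; apply: (submod_sum _ hE) => i _; rewrite mulrA.
  apply: IH; first by have := ltn_ord i; lia.
  by apply: subringM => //; apply: subringN.
move=> _ [p hp ->]; rewrite horner_coef; apply: (submod_sum _ hE) => i _.
exact: uE.
Qed.

(* The rings generated over [R] by finitely many elements of [S] form, when
   enlarged step by step, a chain; it must stop at [S]. *)
Lemma FCP_integral_fg R S : subring R -> subring S -> R `<=` S -> FCP R S ->
  integral_ext R S ->
  exists2 s : seq A, [set` s] `<=` S & S `<=` mspan R [set` s].
Proof.
move=> hR hS RS hF hint; apply: contrapT => hn.
pose gen (s : seq A) := foldr (fun u T => adjoin T u) R s.
have genP s : [set` s] `<=` S -> ivl R S (gen s) /\
    exists2 s' : seq A, [set` s'] `<=` gen s & gen s `<=` mspan R [set` s'].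
  elim: s => [|u s IH] sS /=.
    split; first by split=> //; split.
    exists [:: 1]; first by move=> x /=; rewrite inE => /eqP ->; apply: subring1.
    move=> x Rx; rewrite -[x]mulr1; case: (mspan_submod R [set` [:: 1 : A]]) => _ _; apply => //.
    by apply: mspan_sub; rewrite /= inE.
  have [|[hg [Rg gS]] [s' s'g gs']] := IH.
    by move=> x xs; apply: sS; rewrite /= in_cons; apply/orP; right.
  have Su : S u by apply: sS; rewrite /= mem_head.
  split.
    split; first exact: adjoin_subring.
    split; first exact: subset_trans Rg (@adjoin_sub _ u hg).
    exact: adjoin_min.
  have [n [c [cR cu]]] := hint _ Su.
  by apply: (adjoin_mspan_powers _ _ _ s'g gs' _ cu) => // i; apply: Rg.
(* [h] picks an element of [S] that the list does not yet generate; lists not contained in [S] get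
   an arbitrary value. *)
have /choice[h hP] (s : seq A) : exists u, [set` s] `<=` S -> S u /\ ~ gen s u.
  have [sS|?] := pselect ([set` s] `<=` S); last by exists 0.
  apply: contrapT => hu; apply: hn.
  have [[hg [Rg gS]] [s' s'g gs']] := genP _ sS.
  exists s'; first exact: subset_trans gS.
  move=> x Sx; apply: gs'; apply: contrapT => gx; apply: hu.
  by exists x.
pose s k := iter k (fun s => h s :: s) [::].
have sS k : [set` s k] `<=` S.
  elim: k => [|k IH] x //=; rewrite in_cons => /orP[/eqP ->|/IH //].
  by have [] := hP _ IH.
have mono k : gen (s k) `<=` gen (s k.+1).
  by rewrite /=; apply: adjoin_sub; have [[]] := genP _ (sS k).
have [||i [j [ij e]]] := @FCP_seq _ R S (fun k => gen (s k)) hF.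
- by move=> k; have [] := genP _ (sS k).
- by left.
(* The element added at stage i lies in every later ring, hence in [gen (s j)], which equals
   [gen (s i)]; but it was chosen outside the latter. *)
have [_] := hP _ (sS i); apply; rewrite e.
have le k : gen (s i.+1) `<=` gen (s (k + i.+1)%N).
  by elim: k => // k IH; rewrite addSn; apply: subset_trans (mono _).
rewrite -(subnK ij); apply: le; rewrite /=; apply: adjoin_gen.
by have [[]] := genP _ (sS i).
Qed.

Definition int_closed T S := forall x, S x -> integral_over T x -> T x.

(** With c the coefficient in degree n + 1, multiplying p(v) = 0 by c^n gives a monic relation for c
    v. *)
Lemma integral_lead T p n v : subring T -> coefs_in T p -> (size p <= n.+2)%N ->
  p.[v] = 0 -> integral_over T (p`_n.+1 * v).
Proof.
move=> hT hp sp pv; set c := p`_n.+1.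
exists n.+1, (fun i => p`_i * c ^+ (n - i)); split.
  by move=> i; apply: subringM => //; apply: subringX => //; apply: hp.
transitivity (c ^+ n * p.[v]); last by rewrite pv mulr0.
rewrite (horner_coef_wide v sp) [in RHS]big_ord_recr /= mulrDr mulr_sumr addrC; congr (_ + _).
  apply: eq_bigr => i _; have -> : c ^+ n = c ^+ (n - i) * c ^+ i.
    by rewrite -exprD subnK // -ltnS.
  by rewrite exprMn; ring.
by rewrite exprMn exprS -/c; ring.
Qed.

(* Horner descent: with p = c_n X^n + ..., c_n v is integral, hence in T, so
   the top coefficient can be folded into the next one. *)
Lemma coef_conductor T S p n v : subring T -> subring S -> T `<=` S ->
  int_closed T S -> S v -> coefs_in T p -> (size p <= n.+1)%N -> p.[v] = 0 ->
  forall i, mspan (adjoin T v) [set a | T a /\ T (a * v)] p`_i.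
Proof.
move=> hT hS TS hc Sv; set E := mspan _ _.
have hE : submod (adjoin T v) E by exact: mspan_submod.
have [E0 EB EZ] := hE.
elim: n p => [|n IH] p hp sp pv i.
  have p0 : p`_0 = 0.
    by move: pv; rewrite (horner_coef_wide v sp) big_ord1 expr0 mulr1.
  have [->|i0] := posnP i; first by rewrite p0.
  by rewrite nth_default //; exact: leq_trans sp i0.
set c := p`_n.+1; have Tc : T c by exact: hp.
have Tcv : T (c * v).
  apply: hc; last exact: integral_lead.
  by apply: subringM => //; apply: TS.
have Ec : E c by apply: mspan_sub.
have Ecv : E (c * v) by rewrite mulrC; apply: EZ => //; apply: adjoin_gen.
have hP := coefs_in_subring hT.
pose q := p - c%:P * 'X^(n.+1) + (c * v)%:P * 'X^n.
have qE j : q`_j = p`_j - c *+ (j == n.+1) + c * v *+ (j == n).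
  rewrite /q coefD coefB !coefCM !coefXn. 
  by rewrite !mulr_natr.
have hq : coefs_in T q.
  apply: (subringD hP); first apply: (subringB hP) => //.
    by apply: (subringM hP); [exact: coefs_inC | exact: coefs_inXn].
  by apply: (subringM hP); [exact: coefs_inC | exact: coefs_inXn].
have sq : (size q <= n.+1)%N.
  apply/leq_sizeP => j; rewrite leq_eqVlt => /orP[/eqP <-|lt].
    by rewrite qE eqxx gtn_eqF // subrr addr0.
  rewrite qE !gtn_eqF //; last by apply: ltnW.
  by rewrite subr0 addr0 nth_default //; apply: leq_trans sp lt.
have qv : q.[v] = 0 by rewrite /q !hornerE pv exprS; ring.
have := IH _ hq sq qv i; rewrite qE => h.
have -> : p`_i = (p`_i - c *+ (i == n.+1) + c * v *+ (i == n))
                  - (c * v *+ (i == n) - c *+ (i == n.+1)) by ring.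
by apply: (EB) => //; apply: EB; [case: (i == n)|case: (i == n.+1)].
Qed.

(** A repetition in the decreasing sequence T[v^(2^k)] gives v^m = q(v^l) with 0 < m < l. Then v is
    a root of X^m - q(X^l), whose coefficient at X^m is 1 because l does not divide m, and
    [coef_conductor] applies to that coefficient. *)
Lemma FCP_int_closed_unit T S v : subring T -> subring S -> T `<=` S ->
  FCP T S -> int_closed T S -> S v ->
  mspan (adjoin T v) [set a | T a /\ T (a * v)] 1.
Proof.
move=> hT hS TS hF hc Sv.
have [||i [j [ij e]]] := @FCP_seq _ T S (fun k => adjoin T (v ^+ (2 ^ k))) hF.
- move=> k; split; first exact: adjoin_subring.
  by split; [exact: adjoin_sub | apply: adjoin_min => //; apply: subringX].
- right=> k; apply: adjoin_min; [exact: adjoin_subring | exact: adjoin_sub |].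
  rewrite expnS mulnC exprM; apply: subringX; first exact: adjoin_subring.
  exact: adjoin_gen.
have [q hq qE] : adjoin T (v ^+ (2 ^ j)) (v ^+ (2 ^ i)).
  by rewrite -e; apply: adjoin_gen.
set m := (2 ^ i)%N in qE; set l := (2 ^ j)%N in qE.
have lm : (m < l)%N by rewrite ltn_exp2l.
have m0 : (0 < m)%N by rewrite expn_gt0.
have l0 : (0 < l)%N by exact: ltn_trans lm.
pose p := 'X^m - (q \Po 'X^l).
have hp : coefs_in T p.
  apply: (subringB (coefs_in_subring hT)); first exact: coefs_inXn.
  move=> k; rewrite coef_comp_poly_Xn //; case: ifP => // _; exact: subring0.
have pv : p.[v] = 0 by rewrite !hornerE horner_comp hornerXn qE subrr.
have -> : 1 = p`_m :> A.
  rewrite coefB coefXn eqxx coef_comp_poly_Xn // ifN ?subr0 //.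
  by apply/negP => /(dvdn_leq m0); rewrite leqNgt lm.
exact: (@coef_conductor T S p (size p)).
Qed.

(** The products of elements of I by elements of N lie in both ideals and still generate the unit
    ideal. *)
Lemma mspan_unit_inter R U I N : subring R -> R `<=` U -> subring U ->
  submod R I -> submod R N -> I `<=` R -> N `<=` R ->
  mspan U I 1 -> mspan U N 1 -> mspan U (I `&` N) 1.
Proof.
move=> hR RU hU hI hN IR NR hI1 hN1.
have hE := mspan_submod U (I `&` N).
apply: hI1 => // a Ia; rewrite -[a]mulr1.
apply: (hN1 [set x | mspan U (I `&` N) (a * x)]); first exact: submod_preim.
move=> b Nb; apply: mspan_sub; split.
  by rewrite mulrC; case: hI => _ _; apply => //; apply: NR.
by case: hN => _ _; apply => //; apply: IR.
Qed.

Lemma conductor_submod R u : subring R -> submod R [set a | R a /\ R (a * u)].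
Proof.
move=> hR; split=> /=; first by rewrite mul0r; split; apply: subring0.
  by move=> x y [? ?] [? ?]; rewrite mulrBl; split; apply: subringB.
by move=> r x Rr [? ?]; rewrite -mulrA; split; apply: subringM.
Qed.

Definition conductor R U : set A := [set a | R a /\ forall x, U x -> R (a * x)].

Lemma conductor_ideal R U : subring R -> subring U -> submod U (conductor R U).
Proof.
move=> hR hU; split.
- by split; [exact: subring0 | move=> x _; rewrite mul0r; exact: subring0].
- move=> a b [Ra ha] [Rb hb]; split; first exact: subringB.
  by move=> x Ux; rewrite mulrBl; apply: subringB => //; [apply: ha|apply: hb].
- move=> b a Ub [Ra ha]; split; first by rewrite mulrC; apply: ha.
  move=> x Ux; have -> : b * a * x = a * (b * x) by ring.
  by apply: ha; apply: subringM.
Qed.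

(** Flatness: intersecting the conductors of the u_i gives 1 = sum_j v_j a_j with all a_j u_i in R,
    so u_i = sum_j (a_j u_i) v_j is the required factorization. Epimorphism: the x with f(u) g(x) =
    g(u) g(x) form a U-submodule that contains the conductor of u, where f and g agree on both a and
    a u; hence it contains 1. *)
Lemma conductor_unit_flat_epi R U : subring R -> subring U -> R `<=` U ->
  (forall u, U u -> mspan U [set a | R a /\ R (a * u)] 1) -> flat_epi R U.
Proof.
move=> hR hU RU hL; split.
  move=> n r u Rr Uu ru0.
  pose I := [set a | R a /\ forall i, R (a * u i)].
  have I1 : mspan U I 1.
    have H (s : seq 'I_n) : mspan U [set a | R a /\ forall i, i \in s -> R (a * u i)] 1.
      elim: s => [|i s IH].
        by apply: mspan_sub; split=> //; apply: subring1.
      have hs : submod R [set a | R a /\ forall i, i \in s -> R (a * u i)].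
        split=> /=.
        - split; first exact: subring0.
          by move=> j _; rewrite mul0r; apply: subring0.
        - move=> x y [? hx] [? hy]; split; first exact: subringB.
          by move=> j js; rewrite mulrBl; apply: subringB; [|exact: hx|exact: hy].
        - move=> c x Rc [? hx]; split; first exact: subringM.
          by move=> j js; rewrite -mulrA; apply: subringM => //; apply: hx.
      have := mspan_unit_inter hR RU hU (conductor_submod (u i) hR) hs
        (fun _ => @proj1 _ _) (fun _ => @proj1 _ _) (hL _ (Uu i)) IH.
      apply: mspanS => a [[Ra Rai] [_ Ras]]; split=> // j.
      by rewrite in_cons => /orP[/eqP ->|/Ras].
    have := H (enum 'I_n); apply: mspanS => a [Ra hs]; split=> // i.
    by apply: hs; rewrite mem_enum.
  have [m [v [a [Uv Ia e]]]] := mspan_sum hU I1.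
  exists m, (fun i j => a j * u i), v; split=> //.
  - by move=> i j; have [_] := Ia j.
  - move=> i; rewrite -[LHS]mulr1 e mulr_sumr.
    by apply: eq_bigr => j _; ring.
  - move=> j; transitivity (a j * \sum_(i < n) r i * u i); last by rewrite ru0 mulr0.
    by rewrite mulr_sumr; apply: eq_bigr => i _; ring.
move=> C f g [f1 fh] [g1 gh] fg u Uu.
pose E := [set x | U x /\ f u * g x = g u * g x].
have hom0 (h : A -> C) : (forall x y, U x -> U y ->
    h (x + y) = h x + h y /\ h (x * y) = h x * h y) -> h 0 = 0.
  move=> hh; have U0 := subring0 hU; have [e _] := hh _ _ U0 U0.
  by apply: (addrI (h 0)); rewrite -e !addr0.
have homB (h : A -> C) : (forall x y, U x -> U y ->
    h (x + y) = h x + h y /\ h (x * y) = h x * h y) ->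
    forall x y, U x -> U y -> h (x - y) = h x - h y.
  move=> hh x y Ux Uy; apply: (addIr (h y)); rewrite subrK.
  by have [<- _] := hh _ _ (subringB hU Ux Uy) Uy; rewrite subrK.
have [_] : E 1; last by rewrite g1 !mulr1.
apply: (hL _ Uu).
  split.
  - by split; [exact: subring0 | rewrite (hom0 g) // !mulr0].
  - move=> x y [Ux ex] [Uy ey]; split; first exact: subringB.
    by rewrite (homB g) // !mulrBr ex ey.
  - move=> r x Ur [Ux ex]; split; first exact: subringM.
    by have [_ ->] := gh _ _ Ur Ux; rewrite !(mulrCA _ (g r)) ex.
move=> a [Ra Rau]; split; first exact: RU.
have Ua := RU _ Ra.
have [_ <-] := gh _ _ Uu Ua; rewrite -fg //.
by have [_ <-] := fh _ _ Uu Ua; rewrite (mulrC u) fg.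
Qed.

Lemma FCP_int_closed_prufer R T : subring R -> subring T -> R `<=` T ->
  FCP R T -> int_closed R T -> prufer R T.
Proof.
move=> hR hT RT hF hc U [hU [RU UT]]; apply: conductor_unit_flat_epi => // u Uu.
have := FCP_int_closed_unit hR hT RT hF hc (UT _ Uu).
apply: mspan_min; last exact: mspan_sub.
by apply: submodS (mspan_submod _ _); apply: adjoin_min.
Qed.

End Adjoin.

(** * Integral epimorphisms are onto; comaximality of conductors *)

Section FiniteEpi.
Variable A : comNzRingType.
Implicit Types (R S T U V E I N B : set A) (x y u v w : A) (p q : {poly A}).

Lemma integral_elements_subring R : subring R -> subring (integral_over R).
Proof.
move=> hR; split; first by apply: integral_over_id => //; apply: subring1.
by split=> x y; [exact: integral_overB | exact: integral_overM].
Qed.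

Lemma coefs_in_submod U N : submod U N -> submod (coefs_in U) (coefs_in N : set {poly A}).
Proof.
move=> hN; have [N0 NB NZ] := hN; split=> [i|p q hp hq i|p q hp hq i].
- by rewrite coef0.
- by rewrite coefB; apply: NB.
- by rewrite coefM; apply: (submod_sum _ hN) => j _; apply: NZ.
Qed.

(** * The minimal polynomial of a generator modulo an ideal *)

Section Presentation.
Variables (R N : set A) (u : A).
Let U := adjoin R u.
Hypotheses (hR : subring R) (hN : submod U N).
Hypothesis N_max : forall c, R c -> ~ N c -> exists2 d, R d & N (1 - d * c).
Hypothesis uN : forall r, R r -> ~ N (u - r).
Hypothesis uint : integral_over R u.

Let hU : subring U. Proof. exact: adjoin_subring. Qed.
Let RU : R `<=` U. Proof. exact: adjoin_sub. Qed.
Let Uu : U u. Proof. exact: adjoin_gen. Qed.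
Let UR p : coefs_in R p -> coefs_in U p. Proof. by move=> h i; apply: RU. Qed.
Let hPR : subring (coefs_in R : set {poly A}). Proof. exact: coefs_in_subring. Qed.
Let hPU : subring (coefs_in U : set {poly A}). Proof. exact: coefs_in_subring. Qed.
Let hPN : submod (coefs_in U) (coefs_in N : set {poly A}).
Proof. exact: coefs_in_submod. Qed.

Let N1 : ~ N 1.
Proof.
move=> h; apply: (uN (subring0 hR)); rewrite subr0 -[u]mulr1.
by case: hN => _ _; apply.
Qed.

Let monic_rel d :=
  exists p, [/\ coefs_in R p, p`_d = 1, (size p <= d.+1)%N & N p.[u]].

(** The least d is the degree of the minimal polynomial of the class of u over the field R/(N cap
    R): d = 0 would put 1 in N, and d = 1 would put u in R + N. *)
Lemma ex_minimal_monic_rel : exists2 d, monic_rel d &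
  (1 < d)%N /\ forall k, (k < d)%N -> ~ monic_rel k.
Proof.
have ex : exists d, `[< monic_rel d >].
  have [n [c [cR cu]]] := uint; exists n; apply/asboolP.
  exists ('X^n + \poly_(i < n) (if insub i is Some j then c j else 0)); split.
  - apply: (subringD hPR); first exact: coefs_inXn.
    move=> i; rewrite coef_poly; case: ifP => h; last exact: subring0.
    by rewrite insubT.
  - by rewrite coefD coefXn eqxx coef_poly ltnn addr0.
  - apply: leq_trans (size_polyD _ _) _; rewrite geq_max size_polyXn leqnn /=.
    by apply: leqW; apply: size_poly.
  - suff -> : ('X^n + \poly_(i < n) (if insub i is Some j then c j else 0)).[u] = 0.
      by case: hN.
    rewrite !hornerE horner_poly -[RHS]cu; congr (_ + _).
    by apply: eq_bigr => i _; rewrite /= valK.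
case: (ex_minnP ex) => d /asboolP dP dmin; exists d => //; split; last first.
  by move=> k kd /asboolP /dmin; rewrite leqNgt kd.
case: d dP {dmin} => [|[|//]] [p [hp p1 sp Np]].
  by case: N1; move: Np; rewrite (horner_coef_wide u sp) big_ord1 p1 mul1r expr0.
have /uN : R (- p`_0) by apply: subringN.
case; move: Np; rewrite (horner_coef_wide u sp) !big_ord_recr big_ord0 /= p1.
by rewrite add0r expr0 mulr1 mul1r expr1 opprK addrC.
Qed.

(* The pushout U (x)_R U is replaced by its quotient U[X]/(p0, N), in which the
   two images u and X of the generator differ because deg p0 > 1. *)
Lemma adjoin_not_epi : ~ epimorphism R U.
Proof.
have [d [p0 [hp0 p0d sp0 Np0]] [d1 dmin]] := ex_minimal_monic_rel.
have [N0 NB NZ] := hN; have [PN0 PNB PNZ] := hPN.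
(* Division by p0: over R, a polynomial whose value at u is in N is a multiple of p0 modulo N[X]. *)
have red n : forall q, coefs_in R q -> (size q <= n)%N -> N q.[u] ->
    exists2 s, coefs_in R s & coefs_in N (q - s * p0).
  elim: n => [|k IH] q hq sq Nq.
    exists 0; first exact: (subring0 hPR).
    by move: sq; rewrite leqn0 size_poly_eq0 => /eqP ->; rewrite mul0r subr0.
  set c := q`_k; have Rc : R c by exact: hq.
  have hcX j : coefs_in R (c%:P * 'X^j).
    by apply: (subringM hPR); [exact: coefs_inC | exact: coefs_inXn].
  have drop p : coefs_in R p -> p`_k = c -> (size p <= k.+1)%N ->
      (size (q - p)%R <= k)%N.
    move=> hp pk sp; apply/leq_sizeP => j; rewrite leq_eqVlt => /orP[/eqP <-|lt].
      by rewrite coefB pk subrr.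
    by rewrite coefB !nth_default ?subrr //; [exact: leq_trans sp lt | exact: leq_trans sq lt].
  have [dk|kd] := leqP d k.
    have h1 : coefs_in R (c%:P * 'X^(k - d) * p0) by exact: (subringM hPR).
    have [|||s hs hN'] := IH (q - c%:P * 'X^(k - d) * p0).
    - exact: (subringB hPR).
    - apply: drop => //.
        by rewrite -mulrA coefCM coefXnM ltnNge leq_subr /= subKn // p0d mulr1.
      apply/leq_sizeP => j kj; rewrite -mulrA coefCM coefXnM ifN ?nth_default ?mulr0 //.
        by apply: leq_trans sp0 _; lia.
      by rewrite -leqNgt; lia.
    - rewrite hornerD hornerN; apply: NB => //; rewrite hornerM; apply: NZ => //.
      by apply: horner_coefs_in => //; apply: UR.
    - exists (s + c%:P * 'X^(k - d)); first exact: (subringD hPR).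
      by move: hN'; congr coefs_in; ring.
  have [Nc|Nc] := pselect (N c).
    have cXk : N (c * u ^+ k) by rewrite mulrC; apply: NZ => //; apply: subringX.
    have [|||s hs hN'] := IH (q - c%:P * 'X^k).
    - exact: (subringB hPR).
    - apply: drop => //; first by rewrite coefCM coefXn eqxx mulr1.
      apply/leq_sizeP => j kj; rewrite coefCM coefXn gtn_eqF ?mulr0 //.
    - by rewrite !hornerE; apply: NB.
    - exists s => //.
      have -> : q - s * p0 = (q - c%:P * 'X^k - s * p0) + c%:P * 'X^k by ring.
      apply: (submodD hPN) => // j; rewrite coefCM coefXn.
      by case: eqP => _; rewrite ?mulr1 ?mulr0.
  (* The top coefficient c is invertible modulo N, so e q, corrected to have coefficient 1 at X^k,
     is a monic relation of degree k < d, against minimality. *)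
  exfalso; have [e Re Ne] := N_max Rc Nc.
  apply: (dmin k kd); exists (e%:P * q + (1 - e * c)%:P * 'X^k); split.
  - have R1 : R (1 - e * c).
      by apply: subringB; [|exact: subring1|exact: subringM].
    apply: (subringD hPR); apply: (subringM hPR) => //; try exact: coefs_inC.
    exact: coefs_inXn.
  - by rewrite coefD !coefCM coefXn eqxx mulr1 -/c; ring.
  - apply/leq_sizeP => j kj; rewrite coefD !coefCM coefXn gtn_eqF // mulr0 addr0.
    by rewrite nth_default ?mulr0 //; apply: leq_trans sq kj.
  - rewrite !hornerE; apply: (submodD hN).
      by apply: NZ => //; apply: RU.
    by rewrite mulrC; apply: NZ => //; apply: subringX.
pose I : set {poly A} :=
  [set q | coefs_in U q /\ exists2 s, coefs_in U s & coefs_in N (q - s * p0)].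
have hI : submod (coefs_in U) I.
  split.
  - split; first exact: (subring0 hPU).
    by exists 0; [exact: (subring0 hPU) | rewrite mul0r subr0].
  - move=> p q [hp [s hs hps]] [hq [t ht hqt]]; split; first exact: (subringB hPU).
    exists (s - t); first exact: (subringB hPU).
    have -> : p - q - (s - t) * p0 = (p - s * p0) - (q - t * p0) by ring.
    exact: PNB.
  - move=> r p hr [hp [s hs hps]]; split; first exact: (subringM hPU).
    exists (r * s); first exact: (subringM hPU).
    have -> : r * p - r * s * p0 = r * (p - s * p0) by ring.
    exact: PNZ.
have IXu : ~ I ('X - u%:P).
  move=> [_ [s hs hNs]].
  (* As d > 1, the terms X and u do not contribute to the coefficient of degree m + d. Since p0 is
     monic, descending induction puts every coefficient of s in N; then the coefficient 1 of X would
     be in N too. *)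
  have sN k : forall m, (size s <= m + k)%N -> N s`_m.
    elim: k => [|k IH] m; first by rewrite addn0 => h; rewrite nth_default.
    move=> h; have /= := hNs (m + d)%N.
    rewrite !coefB coefX coefC [_ == 1]gtn_eqF; last by lia.
    rewrite [_ == 0]gtn_eqF; last by lia.
    rewrite subr0 sub0r coefM.
    have mlt : (m < (m + d).+1)%N by lia.
    rewrite (bigD1 (Ordinal mlt)) //= addKn p0d mulr1 => h2.
    set X := (\sum_(i < _ | _) _) in h2.
    have NX : N X.
      apply: (submod_sum _ hN) => i; rewrite -val_eqE /= => im.
      have [lt|le] := ltnP i m.
        by rewrite [p0`_ _]nth_default ?mulr0 //; apply: leq_trans sp0 _; lia.
      rewrite mulrC; apply: NZ; first exact: UR.
      by apply: IH; move: im le h; rewrite leq_eqVlt eq_sym => /negPf -> /=; lia.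
    have -> : s`_m = 0 - (- (s`_m + X)) - X by ring.
    by apply: (NB) => //; apply: NB.
  have sN' : coefs_in N s by move=> m; apply: (sN (size s)); lia.
  have /(_ 1%N) : coefs_in N ('X - u%:P).
    have -> : 'X - u%:P = ('X - u%:P - s * p0) + p0 * s by ring.
    by apply: (submodD hPN) => //; apply: PNZ => //; apply: UR.
  by rewrite coefB coefX coefC subr0.
have I1 : ~ I 1.
  move=> h; apply: IXu; rewrite -['X - _]mulr1; case: hI => _ _; apply => //.
  by apply: (subringB hPU); [exact: coefs_inX | exact: coefs_inC].
have [C [f [[f1 fh] fI]]] := ideal_quotient hPU hI I1.
have redI q : coefs_in R q -> N q.[u] -> I q.
  move=> hq Nq; split; first exact: UR.
  by have [s hs] := red _ _ hq (leqnn _) Nq; exists s => //; apply: UR.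
(* [g] sends q(u) to the class of q, for some q over R representing the element; [redI] makes the
   choice immaterial. So u goes to the class of X, while the other map sends it to the class of the
   constant u. *)
pose g x := f (xget 0 [set q | coefs_in R q /\ x = q.[u]]).
have gE q : coefs_in R q -> g q.[u] = f q.
  move=> hq; rewrite /g; case: xgetP => [q' _ [hq' e]|/(_ q)/=]; last by case.
  apply/fI; [exact: UR | exact: UR|]; apply: redI; first exact: (subringB hPR).
  by rewrite hornerD hornerN e subrr.
move=> epi; apply: IXu; apply/fI; [exact: coefs_inX | exact: coefs_inC |].
rewrite -gE; last exact: coefs_inX.
rewrite hornerX; symmetry; apply: (epi C (fun x => f x%:P) g) => //.
- split; first exact: f1.
  move=> x y Ux Uy; rewrite polyCD polyCM.
  by apply: fh; apply: coefs_inC.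
- split.
    by rewrite -(hornerC 1 u) gE ?f1 //; apply: (subring1 hPR).
  move=> _ _ [p hp ->] [q hq ->]; rewrite -hornerD -hornerM !gE //.
  + by apply: fh; apply: UR.
  + exact: (subringM hPR).
  + exact: (subringD hPR).
- by move=> r Rr; rewrite -{2}(hornerC r u) gE //; apply: coefs_inC.
Qed.

End Presentation.

(** Suppose u is not in R; take a maximal ideal M of R containing the conductor of U = R[u], and N =
    M U. If u is congruent modulo N to no element of R, [adjoin_not_epi] applies. Otherwise U = R +
    M U, and Nakayama gives a in M with (1 - a) U inside R: then 1 - a is in the conductor, hence in
    M, and so is 1. *)
Lemma integral_adjoin_epi R u : subring R -> integral_over R u ->
  FCP R (adjoin R u) -> epimorphism R (adjoin R u) -> R u.
Proof.
move=> hR uint hF epi; apply: contrapT => Ru; set U := adjoin R u in hF epi.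
have hU : subring U by exact: adjoin_subring.
have RU : R `<=` U by exact: adjoin_sub.
have Uu : U u by exact: adjoin_gen.
have hintU : integral_ext R U.
  apply: adjoin_min => //; first exact: integral_elements_subring.
  by move=> x; apply: integral_over_id.
have [s sU Us] := FCP_integral_fg hR hU RU hF hintU.
pose J := conductor R U.
have hJ : submod R J by apply: submodS (conductor_ideal hR hU).
have [||M [hM MR M1 Mmax] JM] := ex_maximal_ideal hR hJ.
- by move=> a [].
- by move=> [_ /(_ _ Uu)]; rewrite mul1r.
pose N := mspan U M; have hN : submod U N by exact: mspan_submod.
have MN : M `<=` N by exact: mspan_sub.
apply: (@adjoin_not_epi R N u) => //.
  move=> c Rc Nc; have [d Rd Md] := Mmax _ Rc (contra_not (@MN c) Nc).
  by exists d => //; apply: MN.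
move=> r Rr Nur; apply: M1.
pose P := [set y | exists a x, [/\ M a, U x & y = a * x]].
have hB : submod R R by exact: submod_subring.
have NP : N `<=` mspan R P.
  apply: mspan_min; last first.
    move=> a Ma; apply: mspan_sub; exists a, 1; split=> //; first exact: subring1.
    by rewrite mulr1.
  have hP := mspan_submod R P; have [P0 PB PZ] := hP; split=> // y z Uy.
  move: z; apply: (@mspan_min _ R P [set z | mspan R P (y * z)]).
    exact: submod_preim.
  move=> _ [a [x [Ma Ux ->]]]; apply: mspan_sub; exists a, (y * x).
  by split=> //; [exact: subringM | ring].
have URN x : U x -> exists2 r, R r & N (x - r).
  move=> Ux; suff [] : U x /\ exists2 r, R r & N (x - r) by [].
  move: x Ux; apply: (@adjoin_min _ R u [set x | U x /\ exists2 r, R r & N (x - r)]).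
  - have [N0 NB NZ] := hN; split.
      by split; [exact: subring1 | exists 1; [exact: subring1 | rewrite subrr]].
    split=> x y [Ux [a Ra Na]] [Uy [b Rb Nb]].
      split; first exact: subringB.
      exists (a - b); first exact: subringB.
      have -> : x - y - (a - b) = (x - a) - (y - b) by ring.
      exact: NB.
    split; first exact: subringM.
    exists (a * b); first exact: subringM.
    have -> : x * y - a * b = x * (y - b) + b * (x - a) by ring.
    by apply: (submodD hN); apply: NZ => //; apply: RU.
  - by move=> x Rx; split; [exact: RU | exists x => //; rewrite subrr; case: hN].
  - by split=> //; exists r.
have [|||a Ma aR] := @nakayama _ R M U s R hR hM MR _ hB RU sU.
- exact: submod_subring.
- by apply: subset_trans Us _; apply: mspanS => x; right.
- move=> x /URN[a Ra /NP hNx]; rewrite -[x](subrK a).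
  apply: (submodD (mspan_submod _ _)); last by apply: mspan_sub; left.
  by move: hNx; apply: mspanS => y; right.
have /JM M1a : J (1 - a).
  by split; [apply: subringB => //; [exact: subring1 | exact: MR] | exact: aR].
by rewrite -[1](subrK a); apply: (submodD hM).
Qed.

Lemma prufer_int_closed R T : subring R -> subring T -> R `<=` T ->
  FCP R T -> prufer R T -> int_closed R T.
Proof.
move=> hR hT RT hF hP u Tu uint.
have uT : adjoin R u `<=` T by exact: adjoin_min.
apply: integral_adjoin_epi => //; first exact: FCP_sub hF.
have [] // := hP (adjoin R u).
by split; [exact: adjoin_subring | split=> //; exact: adjoin_sub].
Qed.

(* With I generated by the a_j, where 1 = sum t_j a_j over T, the rings R + I^k B
   decrease; once they are constant, Nakayama gives a in I with
   (1 - a) I^k B inside R, and multiplying by (I T)^k = T removes I^k. *)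
Lemma conductors_comaximal R B T v : subring R -> subring B -> subring T ->
  R `<=` B -> R `<=` T -> FCP R B -> integral_ext R B -> T `&` B `<=` R ->
  mspan T [set a | R a /\ R (a * v)] 1 ->
  exists a, [/\ R a, R (a * v) & forall x, B x -> R ((1 - a) * x)].
Proof.
move=> hR hB hT RB RT hF hint TB hv.
have [n [t [a [Tt Ia e1]]]] := mspan_sum hT hv.
have [s0 s0B Bs0] := FCP_integral_fg hR hB RB hF hint.
pose step (E : set A) := mspan R [set y | exists j x, E x /\ y = a j * x].
(* [N k] is I^k B, a B-module that is finitely generated over R. *)
pose N k := iter k step B.
have NP k : submod B (N k) /\ N k `<=` B.
  elim: k => [|k [hN NB]]; first by split=> //; apply: submod_subring.
  split.
    have hM := mspan_submod R [set y | exists j x, N k x /\ y = a j * x].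
    have [M0 MB MZ] := hM; split=> // b x Bb; move: x.
    apply: (@mspan_min _ R _ [set x | N k.+1 (b * x)]); first exact: submod_preim.
    move=> _ [j [x [Nx ->]]]; apply: mspan_sub; exists j, (b * x).
    by split; [case: hN => _ _; apply | ring].
  apply: mspan_min; first exact: submod_subring.
  move=> _ [j [x [Nx ->]]]; apply: subringM => //; last exact: NB.
  by apply: RB; have [] := Ia j.
have NS k : N k.+1 `<=` N k.
  apply: mspan_min; first by apply: submodS (NP k).1.
  move=> _ [j [x [Nx ->]]]; case: (NP k) => -[_ _ +] _; apply => //.
  by apply: RB; have [] := Ia j.
have Nfg k : exists2 s : seq A, [set` s] `<=` N k & N k `<=` mspan R [set` s].
  elim: k => [|k [s sN Ns]]; first by exists s0.
  exists [seq a j * x | j <- enum 'I_n, x <- s].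
    move=> _ /allpairsP[[j x] /= [_ xs ->]]; apply: mspan_sub; exists j, x.
    by split=> //; apply: sN.
  apply: mspan_min; first exact: mspan_submod.
  move=> _ [j [x [/Ns Nx ->]]]; move: x Nx.
  apply: (@mspan_min _ R _ [set x | mspan R _ (a j * x)]).
    exact/submod_preim/mspan_submod.
  move=> x xs; apply: mspan_sub => /=; apply/allpairsP; exists (j, x).
  by split=> //; rewrite mem_enum.
pose W k := [set y | exists r x, [/\ R r, N k x & y = r + x]].
have WP k : ivl R B (W k).
  have [hN NB] := NP k; have [N0 NB' NZ] := hN; split; first split.
  - by exists 1, 0; split=> //; [exact: subring1 | rewrite addr0].
  - split=> _ _ [r [x [Rr Nx ->]]] [r' [x' [Rr' Nx' ->]]].
      exists (r - r'), (x - x'); split; [exact: subringB|exact: NB'|ring].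
    exists (r * r'), (r * x' + r' * x + x * x').
    split; [exact: subringM| |ring].
    apply: (submodD hN); last by apply: NZ => //; apply: NB.
    by apply: (submodD hN); apply: NZ => //; apply: RB.
  - split=> [r Rr|_ [r [x [Rr Nx ->]]]]; first by exists r, 0; split=> //; rewrite addr0.
    by apply: subringD => //; [exact: RB | exact: NB].
have WS k : W k.+1 `<=` W k.
  by move=> _ [r [x [Rr Nx ->]]]; exists r, x; split=> //; apply: NS.
have [k Wk] : exists k, W k `<=` W k.+1.
  have [|i [j [ij e]]] := FCP_seq hF WP; first by right.
  exists i; rewrite e.
  have le m : W (m + i.+1)%N `<=` W i.+1.
    by elim: m => // m IH; rewrite addSn; apply: subset_trans IH.
  by rewrite -(subnK ij); apply: le.
pose I := mspan R [set x | exists j, x = a j].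
have hI : submod R I by exact: mspan_submod.
have Icond : I `<=` [set a | R a /\ R (a * v)].
  by apply: mspan_min; [exact: conductor_submod | move=> _ [j ->]].
have IR : I `<=` R by move=> x /Icond[].
have [hW [RW WB]] := WP k.
have [s sN Ns] := Nfg k.
have NW : N k `<=` W k.
  by move=> x Nx; exists 0, x; split=> //; [exact: subring0 | rewrite add0r].
have [|||||b Ib bW] := @nakayama _ R I (W k) s R hR hI IR _ _ RW.
- exact: submod_subring.
- exact: submod_subring.
- exact: subset_trans sN NW.
- move=> _ [r [x [Rr /Ns Nx ->]]]; apply: (submodD (mspan_submod _ _)).
    by apply: mspan_sub; left.
  by move: Nx; apply: mspanS => y; right.
- move=> _ /Wk[r [x [Rr Nx ->]]]; apply: (submodD (mspan_submod _ _)).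
    by apply: mspan_sub; left.
  move: x Nx; apply: mspan_min; first exact: mspan_submod.
  move=> _ [j [x [Nx ->]]]; apply: mspan_sub; right; exists (a j), x.
  by split=> //; [apply: mspan_sub; exists j | apply: NW].
have [Rb Rbv] := Icond _ Ib; exists b; split=> //.
have bN m : (m <= k)%N -> forall x, N (k - m)%N x -> T ((1 - b) * x).
  elim: m => [|m IH] mk x Nx; first by apply: RT; apply: bW; apply: NW; move: Nx; rewrite subn0.
  rewrite -[_ * x]mulr1 [X in _ * X]e1 mulr_sumr; apply: subring_sum => // j _.
  have -> : (1 - b) * x * (t j * a j) = t j * ((1 - b) * (a j * x)) by ring.
  apply: subringM => //; apply: IH; first exact: ltnW.
  have -> : (k - m)%N = (k - m.+1).+1 by lia.
  by apply: mspan_sub; exists j, x.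
move=> x Bx; apply: TB; split; first by apply: (bN k) => //; rewrite subnn.
by apply: subringM => //; apply: subringB => //; [exact: subring1 | exact: RB].
Qed.

End FiniteEpi.

(** * Disjoint supports as comaximality, and the splitting of [R, S] *)

Section Comaximal.
Variable A : comNzRingType.
Variables (R S B : set A).
Hypotheses (hR : subring R) (hS : subring S) (RS : R `<=` S) (hF : FCP R S).
Hypothesis BE : intclos R S = B.
Implicit Types (T U V E I : set A) (x y u v w : A).

Lemma intclos_subring : subring B.
Proof.
by rewrite -BE; exact: subringI hS (integral_elements_subring hR).
Qed.
Let hB := intclos_subring.

Lemma sub_intclos : R `<=` B.
Proof. by rewrite -BE => x Rx; split; [exact: RS | exact: integral_over_id]. Qed.
Let RB := sub_intclos.

Lemma intclos_sub : B `<=` S.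
Proof. by rewrite -BE => x []. Qed.
Let BS := intclos_sub.

Lemma intclos_integral : integral_ext R B.
Proof. by rewrite -BE => x []. Qed.

Let hFB : FCP R B. Proof. exact: FCP_sub hF. Qed.

Lemma ivl_compositum T U : ivl R S T -> ivl R S U -> ivl R S (compositum T U).
Proof.
move=> [hT [RT TS]] [hU [RU US]]; split; first exact: compositum_subring.
split; first exact: subset_trans (@compositum_subl _ _ _).
exact: compositum_min.
Qed.

Lemma int_closed_intclos T : ivl R S T -> int_closed R T <-> T `&` B `<=` R.
Proof.
rewrite -BE => -[hT [RT TS]]; split=> h x.
  by move=> [Tx [_]]; exact: h.
by move=> Tx xint; apply: h; split=> //; split=> //; apply: TS.
Qed.

Lemma prufer_intclos T : ivl R S T -> prufer R T <-> T `&` B `<=` R.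
Proof.
move=> hT'; have [hT [RT TS]] := hT'; rewrite -int_closed_intclos //.
have hFT : FCP R T by exact: FCP_sub hF.
by split=> h; [exact: prufer_int_closed | exact: FCP_int_closed_prufer].
Qed.

Local Notation J := (conductor R B).

Let hJ : submod B J. Proof. exact: conductor_ideal. Qed.
Let hJR : submod R J. Proof. exact: submodS hJ. Qed.

Let R1B a : J a -> R (1 - a).
Proof. by move=> [Ra _]; apply: subringB => //; apply: subring1. Qed.

Let J1M a b : J a -> J b -> exists2 c, J c & 1 - c = (1 - a) * (1 - b).
Proof.
move=> Ja Jb; exists (a + (1 - a) * b); last by ring.
by apply: (submodD hJ) => //; case: hJR => _ _; apply => //; apply: R1B.
Qed.

(** For every v, the ideal J and the ideal of the elements of R that send v into B have sum R. *)
Definition comaximal : Prop :=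
  forall v, S v -> exists2 a, J a & B ((1 - a) * v).

(** The elements 1 - a with a in J form a multiplicative set, and this is the preimage of the
    localization of P at it. Being a ring, it contains a compositum as soon as it contains both
    factors. *)
Lemma almost_in_subring (P : set A) : subring P -> R `<=` P ->
  subring [set v | exists2 a, J a & P ((1 - a) * v)].
Proof.
move=> hP RP; split.
  exists 0; first by case: hJ.
  by rewrite subr0 mulr1; apply: subring1.
split=> x y [a Ja ax] [b Jb bx]; have [c Jc ce] := J1M Ja Jb; exists c => //; rewrite ce.
  have -> : (1 - a) * (1 - b) * (x - y)
    = (1 - b) * ((1 - a) * x) - (1 - a) * ((1 - b) * y) by ring.
  by apply: subringB => //; apply: subringM => //; apply/RP/R1B.
have -> : (1 - a) * (1 - b) * (x * y) = ((1 - a) * x) * ((1 - b) * y) by ring.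
exact: subringM.
Qed.

Lemma almost_in_base T : ivl R S T -> T `&` B `<=` R ->
  forall t, T t -> exists2 a, J a & R ((1 - a) * t).
Proof.
move=> hT' TB t Tt; have [hT [RT TS]] := hT'.
have hv := FCP_int_closed_unit hR hT RT (FCP_sub (fun=> id) TS hF)
  ((int_closed_intclos hT').2 TB) Tt.
have [|a [Ra Rat aB]] := conductors_comaximal hR hB hT RB RT hFB intclos_integral TB (v := t).
  move: hv; apply: mspan_min; last exact: mspan_sub.
  by apply: submodS (mspan_submod _ _); apply: adjoin_min.
(* [conductors_comaximal] puts a t in R and 1 - a in J, so 1 - a is the witness. *)
exists (1 - a); last by rewrite subKr.
by split=> //; apply: subringB => //; apply: subring1.
Qed.

Lemma comaximal_compositum T : ivl R S T -> T `&` B `<=` R ->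
  S `<=` compositum T B -> comaximal.
Proof.
move=> hT TB STB v /STB; move: v; apply: (compositum_min (almost_in_subring hB RB)).
  move=> t /(almost_in_base hT TB)[a Ja at']; exists a => //; exact: RB.
move=> b Bb; exists 0; first by case: hJ.
by rewrite subr0 mul1r.
Qed.

(** Clearing denominators: for a single a in J, the factor 1 - a brings all the coefficients of the
    equation of v over T into R, and (1 - a) v is then integral over R. *)
Lemma comaximal_integral T : ivl R S T -> T `&` B `<=` R ->
  integral_ext T S -> comaximal.
Proof.
move=> hT TB hint v Sv; have [n [c [cT cv]]] := hint _ Sv.
have [a Ja aR] : exists2 a, J a & forall i, R ((1 - a) * c i).
  suff [a Ja aR] : exists2 a, J a & forall i, i \in enum 'I_n -> R ((1 - a) * c i).
    by exists a => // i; apply: aR; rewrite mem_enum.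
  elim: (enum 'I_n) => [|i s [a Ja aR]]; first by exists 0 => //; case: hJ.
  have [b Jb bR] := almost_in_base hT TB (cT i).
  have [d Jd de] := J1M Ja Jb; exists d => // j.
  rewrite in_cons de => /orP[/eqP ->|/aR h].
    by rewrite -mulrA; apply: subringM => //; apply: R1B.
  by rewrite (mulrC (1 - a)) -mulrA; apply: subringM => //; apply: R1B.
exists a => //; rewrite -BE; split.
  by apply: subringM => //; apply/RS/R1B.
(* The coefficients are (1 - a)^(n - i) c_i; since i < n, one factor 1 - a is available to bring c_i
   into R. *)
exists n, (fun i : 'I_n => (1 - a) ^+ (n - i).-1 * ((1 - a) * c i)); split.
  by move=> i; apply: subringM => //; apply: subringX => //; apply: R1B.
transitivity ((1 - a) ^+ n * (v ^+ n + \sum_(i < n) c i * v ^+ i)); last by rewrite cv mulr0.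
rewrite mulrDr mulr_sumr exprMn; congr (_ + _); apply: eq_bigr => i _.
have -> : (1 - a) ^+ n = (1 - a) ^+ (n - i).-1 * ((1 - a) * (1 - a) ^+ i).
  by rewrite -exprS -exprD; congr (_ ^+ _); have := ltn_ord i; lia.
by rewrite exprMn; ring.
Qed.

(** A prime in both supports contains both a and 1 - a. Conversely, if comaximality fails at v, the
    ideal J + (B : v) of R lies in a maximal ideal M. Then v shows that M supports S/B. If M did not
    support B/R, multiplying elements outside M that send the finitely many generators of B into R
    would give an element of J outside M. *)
Lemma comaximal_supp : Supp R B R `&` Supp R S B = set0 <-> comaximal.
Proof.
split=> [h0 v Sv|hc]; last first.
  rewrite -subset0 => P [[hP [u [Bu hu]]] [_ [v [Sv hv]]]].
  have [[PR P0 PB PZ] [P1 _]] := hP.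
  have [a Ja av] := hc _ Sv.
  have Pa : P a.
    apply: contrapT => nPa; apply: (hu a) => //; first by case: Ja.
    by case: Ja => _; apply.
  have Pb : P (1 - a) by apply: contrapT => nPb; apply: (hv (1 - a)) => //; apply: R1B.
  apply: P1; have -> : 1 = (1 - a) - (0 - a) :> A by ring.
  by apply: (PB) => //; apply: PB.
apply: contrapT => hn.
pose I := [set x | exists a b, [/\ J a, R b, B (b * v) & x = a + b]].
have [||| M hM IM] := @ex_maximal_ideal _ R I hR.
- have [J0 JB JZ] := hJR; split.
  + exists 0, 0; split=> //; [exact: subring0| |by rewrite addr0].
    by rewrite mul0r; apply: subring0.
  + move=> _ _ [a [b [Ja Rb Bb ->]]] [a' [b' [Ja' Rb' Bb' ->]]].
    exists (a - a'), (b - b'); split; [exact: JB|exact: subringB| |ring].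
    by rewrite mulrBl; apply: subringB.
  + move=> r _ Rr [a [b [Ja Rb Bb ->]]].
    exists (r * a), (r * b); split; [exact: JZ|exact: subringM| |ring].
    by rewrite -mulrA; apply: subringM => //; apply: RB.
- by move=> _ [a [b [[Ra _] Rb _ ->]]]; apply: subringD.
- move=> [a [b [Ja Rb Bb e]]]; apply: hn; exists a => //.
  by rewrite e addrAC subrr add0r.
have hMp := maximal_ideal_prime hR hM; have [[_ _ _ _] [M1 Mp]] := hMp.
suff : set0 M by [].
rewrite -h0; split; split=> //; last first.
  exists v; split=> // s Rs Ms Bs; apply: Ms; apply: IM; exists 0, s.
  by split=> //; [case: hJ | rewrite add0r].
have [s sB Bs] := FCP_integral_fg hR hB RB hFB intclos_integral.
apply: contrapT => hu.
have killer u : B u -> exists c, [/\ R c, ~ M c & R (c * u)].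
  move=> Bu; apply: contrapT => hk; apply: hu; exists u; split=> // c Rc Mc Rcu.
  by apply: hk; exists c.
suff [c [Rc Mc cs]] : exists c, [/\ R c, ~ M c & forall x, x \in s -> R (c * x)].
  apply: Mc; apply: IM; exists c, 0; split; [|exact: subring0| |by rewrite addr0].
    split=> // x /Bs; apply: (@mspan_min _ R _ [set x | R (c * x)]); last exact: cs.
    by apply: submod_preim; apply: submod_subring.
  by rewrite mul0r; apply: subring0.
elim: s sB {Bs} => [|x s IH] sB.
  by exists 1; split=> //; exact: subring1.
have [|c [Rc Mc cs]] := IH.
  by move=> y ys; apply: sB; rewrite /= in_cons; apply/orP; right.
have [|d [Rd Md dx]] := killer x; first by apply: sB; rewrite /= mem_head.
exists (c * d); split; first exact: subringM.
  by move=> /Mp[].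
move=> y; rewrite in_cons => /orP[/eqP ->|ys].
  by rewrite -mulrA; apply: subringM.
by rewrite (mulrC c) -mulrA; apply: subringM => //; apply: cs.
Qed.

Definition split_map T := (T `&` B, compositum T B).

Definition split_iso : Prop :=
  order_iso (ivl R S) (ivl R B `*` ivl B S) subset (@pair_le A) split_map.

Lemma split_map_homo T T' : T `<=` T' -> pair_le (split_map T) (split_map T').
Proof. by move=> TT; split; [exact: setSI | exact: compositumS]. Qed.

Lemma split_map_ivl T : ivl R S T -> (ivl R B `*` ivl B S) (split_map T).
Proof.
move=> [hT [RT TS]]; split; split=> /=.
- exact: subringI.
- by split; [move=> x Rx; split; [exact: RT|exact: RB] | move=> x []].
- exact: compositum_subring.
- by split; [exact: compositum_subr | exact: compositum_min].
Qed.

(** Any x in J V is sent into J by some 1 - a, since V is sent into B and J is an ideal of B. If x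
    is in B, then a x is in R as well, and x is the sum of the two. *)
Lemma ideal_cap V : ivl B S V -> comaximal -> mspan V J `&` B `<=` R.
Proof.
move=> [hV [BV VS]] hc x [hx Bx].
have [Vx [a Ja [Rax _]]] : V x /\ exists2 a, J a & J ((1 - a) * x).
  move: hx; apply: (@mspan_min _ V J [set x | V x /\ exists2 a, J a & J ((1 - a) * x)]).
    have [J0 JB JZ] := hJ; have [_ _ JZR] := hJR; split.
    - by split; [exact: subring0 | exists 0; rewrite ?mulr0].
    - move=> y z [Vy [a Ja ay]] [Vz [b Jb bz]]; split; first exact: subringB.
      have [c Jc ce] := J1M Ja Jb; exists c => //; rewrite ce.
      have -> : (1 - a) * (1 - b) * (y - z)
        = (1 - b) * ((1 - a) * y) - (1 - a) * ((1 - b) * z) by ring.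
      by apply: JB; apply: JZR => //; apply: R1B.
    - move=> w y Vw [Vy [a Ja ay]]; split; first exact: subringM.
      have [b Jb bw] := hc _ (VS _ Vw); have [c Jc ce] := J1M Ja Jb.
      exists c => //; rewrite ce.
      have -> : (1 - a) * (1 - b) * (w * y) = ((1 - b) * w) * ((1 - a) * y) by ring.
      exact: JZ.
  move=> y Jy; split; first by apply/BV/RB; case: Jy.
  by exists 0; [case: hJ | rewrite subr0 mul1r].
have -> : x = a * x + (1 - a) * x by ring.
by apply: subringD => //; case: Ja => _; apply.
Qed.

(* The inverse of the splitting sends (U, V) to U + JV, J the conductor of B. *)
Lemma comaximal_split : comaximal -> split_iso.
Proof.
move=> hc; split; first exact: split_map_ivl.
- move=> [U V] [/= [hU [RU UB]] hV']; have [hV [BV VS]] := hV'.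
  have cap := ideal_cap hV' hc.
  have hJV := mspan_submod V J; have [JV0 JVB JVZ] := hJV.
  have JV : J `<=` V by move=> x [/RB/BV].
  have JVV : mspan V J `<=` V by apply: mspan_min => //; apply: submod_subring.
  pose T := [set x | exists u w, [/\ U u, mspan V J w & x = u + w]].
  have UV : U `<=` V by exact: subset_trans BV.
  have UT : U `<=` T by move=> u Uu; exists u, 0; rewrite addr0.
  have TV : T `<=` V.
    by move=> _ [u [w [/UV Uu /JVV Vw ->]]]; apply: subringD.
  have hT : subring T.
    split; first by apply: UT; apply: subring1.
    split=> _ _ [u [w [Uu Vw ->]]] [u' [w' [Uu' Vw' ->]]].
      exists (u - u'), (w - w'); split; [exact: subringB|exact: JVB|ring].
    exists (u * u'), (u * w' + u' * w + w * w').
    split; [exact: subringM| |ring].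
    apply: (submodD hJV); last by apply: JVZ => //; apply: JVV.
    by apply: (submodD hJV); apply: JVZ => //; apply: UV.
  exists T.
    split=> //; split; first exact: subset_trans UT.
    exact: subset_trans VS.
  rewrite /split_map; congr (_, _); apply/seteqP; split.
  + move=> _ [[u [w [Uu Vw ->]]] Buw]; apply: subringD => //; apply: RU.
    apply: cap; split=> //; have -> : w = (u + w) - u by ring.
    by apply: subringB => //; apply: UB.
  + by move=> u Uu; split; [exact: UT | exact: UB].
  + exact: compositum_min.
  + move=> v Vv; have [a Ja av] := hc _ (VS _ Vv).
    have -> : v = v * a + (1 - a) * v by ring.
    apply: (subringD (compositum_subring _ _)); last exact: compositum_subr.
    apply: compositum_subl; exists 0, (v * a).
    split; [exact: subring0 | by apply: JVZ => //; exact: mspan_sub | by rewrite add0r].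
- move=> T T' [hT [RT TS]] [hT' [RT' TS']]; split; first exact: split_map_homo.
  move=> [/= h1 h2] t Tt; have [a Ja at'] := hc _ (TS _ Tt).
  (* The first term is in T' because t is in T' B and a B lies in R; the second is in T cap B, hence
     in T'. *)
  have -> : t = a * t + (1 - a) * t by ring.
  have [Ra Ja'] := Ja.
  apply: subringD => //; last first.
    suff [] : (T' `&` B) ((1 - a) * t) by [].
    by apply: h1; split=> //; apply: subringM => //; apply/RT/R1B.
  have : mspan T' B t.
    by apply: compositum_mspan => //; apply: h2; apply: compositum_subl.
  apply: (@mspan_min _ T' B [set t | T' (a * t)]).
    by apply: submod_preim; apply: submod_subring.
  by move=> b Bb; apply: RT'; apply: Ja'.
Qed.

(** * A complement of the integral closure: isomorphisms and supports *)

Section Complement.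
Variable T0 : set A.
Hypotheses (hT0 : ivl R S T0) (T0B : T0 `&` B `<=` R) (ST0 : S `<=` compositum T0 B).

Let hcomax : comaximal. Proof. exact: comaximal_compositum ST0. Qed.
Let hiso : split_iso. Proof. exact: comaximal_split. Qed.
Let iso_sub T T' : ivl R S T -> ivl R S T' ->
  T `&` B `<=` T' `&` B -> compositum T B `<=` compositum T' B -> T `<=` T'.
Proof. by move=> hT hT' h1 h2; case: hiso => _ _ /(_ _ _ hT hT')[_]; apply. Qed.
Let iso_ex U V : ivl R B U -> ivl B S V ->
  exists T, [/\ ivl R S T, T `&` B = U & compositum T B = V].
Proof.
move=> hU hV; case: hiso => _ /(_ (U, V))[//|T hT [e1 e2]] _.
by exists T.
Qed.

Let ivl_R_T0 T : ivl R T0 T -> ivl R S T /\ T `&` B `<=` R.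
Proof.
have [_ [_ T0S]] := hT0; move=> [hT [RT TT0]]; split.
  by split=> //; split=> //; apply: subset_trans T0S.
by move=> x [/TT0 T0x Bx]; apply: T0B.
Qed.

Let sub_T0 T : ivl R S T -> T `&` B `<=` R -> T `<=` T0.
Proof.
move=> hT TB; apply: iso_sub => //.
  by move=> x /TB Rx; split; [case: hT0 => _ [+ _]; apply | apply: RB].
case: hT => hT [_ TS]; apply: subset_trans ST0; exact: compositum_min.
Qed.

Let ivl_RB U : ivl R B U -> ivl R S U.
Proof. by move=> [hU [RU UB]]; split=> //; split=> //; apply: subset_trans BS. Qed.

(** Let X be the ring with image (U, TB) under the splitting. It contains T and U, and comparing
    images shows that it is contained in TU. *)
Lemma complement_join T U : ivl R T0 T -> ivl R B U ->
  compositum T U `&` B = U /\ compositum (compositum T U) B = compositum T B.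
Proof.
move=> /ivl_R_T0[hT TB] hU; have [hT' [RT TS]] := hT; have [hU' [RU UB]] := hU.
have [|X [hX XU XV]] := @iso_ex U (compositum T B) hU.
  split; first exact: compositum_subring.
  by split; [exact: compositum_subr | exact: compositum_min].
suff -> : compositum T U = X by rewrite XU XV.
have UX : U `<=` X by rewrite -XU => x [].
apply/seteqP; split.
  apply: compositum_min => //; first by case: hX.
  apply: iso_sub => //; last by rewrite XV.
  by rewrite XU => x /TB /RU.
apply: iso_sub => //; first by apply: ivl_compositum => //; apply: ivl_RB.
  rewrite XU => x Ux; split; [exact: compositum_subr | exact: UB].
by rewrite XV; apply: compositumS => //; apply: compositum_subl.
Qed.

(** T0 has image (R, S), so [R, T0] consists of the T with T cap B = R: it is a fibre of the first
    projection of the splitting. *)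
Lemma complement_iso_upper :
  order_iso (ivl R T0) (ivl B S) subset subset (fun T => compositum T B).
Proof.
split.
- by move=> T /ivl_R_T0[hT _]; have [] := split_map_ivl hT.
- move=> V hV; have [|T [hT TB TV]] := @iso_ex R V _ hV; first by split=> //; split.
  exists T => //; have [hT' [RT _]] := hT; split=> //; split=> //.
  by apply: sub_T0 => //; rewrite TB.
- move=> T T' /ivl_R_T0[hT TB] /ivl_R_T0[hT' TB']; split=> h; first exact: compositumS.
  apply: iso_sub => // x /TB Rx; split; [by case: hT' => _ [+ _]; apply | exact: RB].
Qed.

Lemma complement_iso_prod : order_iso (ivl R T0 `*` ivl R B) (ivl R S)
  (@pair_le A) subset (fun p => compositum p.1 p.2).
Proof.
split.
- move=> [T U] [/= /ivl_R_T0[hT _] /ivl_RB hU]; exact: ivl_compositum.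
- move=> X hX; have [hX1 hX2] := split_map_ivl hX.
  have [_ /(_ _ hX2)[T hT TV] _] := complement_iso_upper.
  have [e1 e2] := complement_join hT hX1.
  exists (T, X `&` B) => //=; have [hT' _] := ivl_R_T0 hT.
  have hC : ivl R S (compositum T (X `&` B)) by apply: ivl_compositum => //; apply: ivl_RB.
  by apply/seteqP; split; apply: iso_sub; rewrite ?e1 ?e2 ?TV.
- move=> [T U] [T' U'] [/= hT hU] [/= hT' hU']; split=> [[/= h1 h2]|h].
    exact: compositumS.
  have [e1 e2] := complement_join hT hU; have [e1' e2'] := complement_join hT' hU'.
  have [/= h1 h2] := split_map_homo h; split=> /=; first last.
    by rewrite -e1 -e1'.
  have [_ _ iso] := complement_iso_upper.
  by apply/iso => //; rewrite -e2 -e2'.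
Qed.

Lemma compositumC T U : compositum T U = compositum U T.
Proof.
by apply/seteqP; split; apply: compositum_min;
  do ?[exact: compositum_subring|exact: compositum_subl|exact: compositum_subr].
Qed.

(** Dually, [T0, S] consists of the X with XB = S, a fibre of the second projection. *)
Lemma complement_iso_lower :
  order_iso (ivl R B) (ivl T0 S) subset subset (fun U => compositum U T0).
Proof.
have [hT [RT TS]] := hT0; have hTT : ivl R T0 T0 by split=> //; split.
have T0V : compositum T0 B = S by apply/seteqP; split=> //; apply: compositum_min.
split.
- move=> U hU; have [hC [_ CS]] := ivl_compositum (ivl_RB hU) hT0.
  by split=> //; split=> //; apply: compositum_subr.
- move=> X [hX [TX XS]].
  have hX' : ivl R S X by split=> //; split=> //; apply: subset_trans TX.
  have [hXB _] := split_map_ivl hX'.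
  exists (X `&` B) => //; rewrite compositumC.
  have [e1 e2] := complement_join hTT hXB.
  have hC : ivl R S (compositum T0 (X `&` B)) by apply: ivl_compositum => //; apply: ivl_RB.
  have XV : compositum X B = S.
    apply/seteqP; split; first exact: compositum_min.
    by rewrite -T0V; apply: compositumS.
  by apply/seteqP; split; apply: iso_sub; rewrite ?e1 ?e2 ?T0V ?XV.
- move=> U U' hU hU'; split=> h; first exact: compositumS.
  have [e1 _] := complement_join hTT hU; have [e1' _] := complement_join hTT hU'.
  by rewrite -e1 -e1'; apply: setSI; rewrite ![compositum T0 _]compositumC.
Qed.

Let decompose v : S v -> exists2 a, J a & T0 (a * v) /\ B ((1 - a) * v).
Proof.
move=> Sv; have [a Ja av] := hcomax Sv; exists a => //; split=> //.
have [hT [RT TS]] := hT0; have [Ra Ja'] := Ja.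
have : mspan T0 B v by apply: compositum_mspan => //; apply: ST0.
apply: (@mspan_min _ T0 B [set v | T0 (a * v)]).
  by apply: submod_preim; apply: submod_subring.
by move=> b Bb; apply: RT; apply: Ja'.
Qed.

(** S = T0 + B by [decompose] and T0 cap B = R, so S/B and T0/R are isomorphic; exchanging T0 and B
    gives the next lemma. *)
Lemma complement_supp_upper : Supp R S B = Supp R T0 R.
Proof.
have [hT [RT TS]] := hT0; apply/seteqP; split=> P [hP [v [hv hs]]]; split=> //.
  have [a Ja [Tav Bv]] := decompose hv; exists (a * v); split=> // s Rs Ps Rsav.
  apply: (hs s) => //; have -> : s * v = s * (a * v) + s * ((1 - a) * v) by ring.
  by apply: subringD => //; [exact: RB | apply: subringM => //; exact: RB].
exists v; split; first exact: TS.
move=> s Rs Ps Bsv; apply: (hs s) => //; apply: T0B; split=> //.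
by apply: subringM => //; apply: RT.
Qed.

Lemma complement_supp_lower : Supp R S T0 = Supp R B R.
Proof.
have [hT [RT TS]] := hT0; apply/seteqP; split=> P [hP [v [hv hs]]]; split=> //.
  have [a Ja [Tav Bv]] := decompose hv; exists ((1 - a) * v); split=> // s Rs Ps Rsav.
  apply: (hs s) => //; have -> : s * v = s * (a * v) + s * ((1 - a) * v) by ring.
  by apply: subringD => //; [apply: subringM => //; exact: RT | exact: RT].
exists v; split; first exact: BS.
move=> s Rs Ps Tsv; apply: (hs s) => //; apply: T0B; split=> //.
by apply: subringM => //; apply: RB.
Qed.

End Complement.
End Comaximal.

(** * Injectivity of the splitting map *)

Section Restriction.
Variable A : comNzRingType.
Implicit Types R S T U C V B : set A.

Lemma intclos_ivl R S C V : subring R -> subring C ->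
  R `<=` C -> C `<=` intclos R S -> intclos R S `<=` V -> V `<=` S ->
  intclos C V = intclos R S.
Proof.
move=> hR hC RC CB BV VS; apply/seteqP; split=> x [hx xint].
  split; first exact: VS.
  by apply: integral_over_trans xint => // y /CB[].
split; first by apply: BV.
by case: xint => n [c [cR e]]; exists n, c; split=> // i; apply: RC.
Qed.

(** Comaximality may fail for R in S, but it holds for C = T cap B in V = TB, where T is a
    complement of B. As T and T' have the same image, both lie in [C, V], and the splitting there
    separates them. *)
Lemma split_map_inj R S T T' : subring R -> subring S -> R `<=` S -> FCP R S ->
  ivl R S T -> ivl R S T' ->
  split_map (intclos R S) T = split_map (intclos R S) T' -> T = T'.
Proof.
move=> hR hS RS hF; set B := intclos R S.
wlog suff W : T T' / ivl R S T -> ivl R S T' -> split_map B T = split_map B T' -> T `<=` T'.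
  by move=> hT hT' e; apply/seteqP; split; apply: W.
move=> hT1 hT1' [eC eV].
have [[hC [RC CB]] [hV [BV VS]]] := split_map_ivl hR hS RS (erefl B) hT1.
have [hT [RT TS]] := hT1; have [hT' [RT' TS']] := hT1'.
move: hC RC CB hV BV VS; rewrite /= -/B; set C := T `&` B; set V := compositum T B.
move=> hC RC CB hV BV VS.
have CV : C `<=` V by exact: subset_trans BV.
have e : intclos C V = B by exact: intclos_ivl.
have hFC : FCP C V by exact: FCP_sub hF.
have ivT : ivl C V T by split=> //; split; [move=> x [] | exact: compositum_subl].
have ivT' : ivl C V T'.
  split=> //; split; first by rewrite /C eC => x [].
  by rewrite /V eV; exact: compositum_subl.
have hc := comaximal_compositum hC hV CV hFC e ivT (fun x => id) (fun x => id).
have [_ _ iso] := comaximal_split hC hV CV e hc.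
apply/iso => //; split; rewrite /split_map /=; first by rewrite eC.
by rewrite eV.
Qed.

End Restriction.

(** * Cardinals of finite intervals *)

Section Counting.
Implicit Types X Y : choiceType.

Lemma ncard_image X Y (D : set X) (f : X -> Y) : finite_set D ->
  (forall x y, D x -> D y -> f x = f y -> x = y) -> ncard (f @` D) = ncard D.
Proof.
move=> fD inj; rewrite /ncard fset_set_image // card_in_imfset //=.
by move=> x y; rewrite !in_fset_set // !inE; apply: inj.
Qed.

Lemma ncard_subset X (D D' : set X) : finite_set D' -> D `<=` D' ->
  ncard D = ncard D' -> D = D'.
Proof.
move=> fD' DD' e; have fD : finite_set D by exact: sub_finite_set fD'.
apply: fset_set_inj => //; apply/eqP; rewrite eqEfcard.
by apply/andP; split; [rewrite -[is_true _]fset_set_sub | rewrite -[(_ <= _)%N]/(ncard D' <= ncard D)%N e].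
Qed.

Lemma ncardX X Y (D : set X) (D' : set Y) : finite_set D -> finite_set D' ->
  ncard (D `*` D') = (ncard D * ncard D')%N.
Proof.
move=> fD fD'; rewrite /ncard fset_setX // -(size_allpairs pair).
apply/perm_size/uniq_perm; first exact: fset_uniq.
  by apply: allpairs_uniq; rewrite ?fset_uniq // => -[? ?] [? ?].
move=> [x y]; rewrite in_fsetM; apply/idP/allpairsP => /= [/andP[Dx Dy]|[p [Dx Dy e]]].
  by exists (x, y).
by case: e => -> ->; rewrite Dx.
Qed.

Lemma ncard_order_iso X Y (D : set X) (D' : set Y) leX leY (f : X -> Y) :
  (forall x y, leX x y -> leX y x -> x = y) -> (forall y, leY y y) ->
  finite_set D -> order_iso D D' leX leY f -> ncard D = ncard D'.
Proof.
move=> anti refl fD [fDD' surj mono].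
have -> : D' = f @` D.
  apply/seteqP; split=> [y /surj[x Dx <-]|_ [x Dx <-]]; last exact: fDD'.
  by exists x.
rewrite ncard_image // => x y Dx Dy e.
by apply: anti; apply/mono => //; rewrite e.
Qed.

End Counting.

Lemma pair_le_anti (A : Type) (p q : set A * set A) :
  pair_le p q -> pair_le q p -> p = q.
Proof.
by case: p q => [a b] [c d] [/= ? ?] [/= ? ?]; congr (_, _); apply/seteqP.
Qed.

Lemma subset_anti (A : Type) (X Y : set A) : X `<=` Y -> Y `<=` X -> X = Y.
Proof. by move=> ? ?; apply/seteqP. Qed.

(** Polynomials and quotients were treated over a nonzero ring; the equality of structures lets the
    final theorem substitute one. *)
Lemma comNzRing_of_comPzRing (A : comPzRingType) : (1 : A) <> 0 ->
  exists A' : comNzRingType, A = A' :> comPzRingType.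
Proof.
case: A => T c /eqP h; pose A := GRing.ComPzRing.Pack c.
pose M := GRing.PzSemiRing_isNonZero.Build A h.
pose A' : comNzRingType := HB.pack T A M.
by exists A'.
Qed.

(** * Each condition means that the hull and the integral closure generate S *)

Section Main.
Variable A : comNzRingType.
Variables R S H : set A.
Hypotheses (hR : subring R) (hS : subring S) (RS : R `<=` S) (hF : FCP R S).
Hypothesis hH : prufer_hull R S H.
Local Notation B := (intclos R S).

Let hB : subring B. Proof. exact: (intclos_subring hR hS (erefl B)). Qed.
Let RB : R `<=` B. Proof. exact: (sub_intclos hR RS (erefl B)). Qed.
Let BS : B `<=` S. Proof. exact: (intclos_sub (erefl B)). Qed.
Let hHi : ivl R S H. Proof. by case: hH. Qed.
Let hHs : subring H. Proof. by case: hHi. Qed.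
Let RH : R `<=` H. Proof. by case: hHi => _ []. Qed.
Let HS : H `<=` S. Proof. by case: hHi => _ []. Qed.

Lemma hull_cap : H `&` B `<=` R.
Proof. by apply/(prufer_intclos hR hF (erefl B) hHi); case: hH. Qed.

Let S' := compositum H B.
Let hS' : subring S'. Proof. exact: compositum_subring. Qed.
Let S'S : S' `<=` S. Proof. exact: compositum_min. Qed.
Let HS' : H `<=` S'. Proof. exact: compositum_subl. Qed.
Let BS' : B `<=` S'. Proof. exact: compositum_subr. Qed.
Let RS' : R `<=` S'. Proof. exact: subset_trans BS'. Qed.
Let hF' : FCP R S'. Proof. exact: FCP_sub hF. Qed.
Let BE' : intclos R S' = B. Proof. exact: intclos_ivl. Qed.
Let hHi' : ivl R S' H. Proof. by split=> //; split. Qed.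

(** T cap B = R makes T Prüfer, so T lies in the hull and S = TB lies in HB. *)
Lemma hull_generates_of_complement :
  (exists2 T, ivl R S T & split_map B T = (R, S)) -> S `<=` S'.
Proof.
move=> [T hT [e1 e2]]; rewrite -e2; apply: compositumS => //; case: hH => _ _; apply => //.
by apply/(prufer_intclos hR hF (erefl B) hT); rewrite e1.
Qed.

Let ivl_RS : (ivl R B `*` ivl B S) (R, S).
Proof. by split; split=> //; split. Qed.

Lemma supp_hull_generates :
  Supp R B R `&` Supp R S B = set0 <-> S `<=` S'.
Proof.
rewrite (comaximal_supp hR hS RS hF (erefl B)); split=> [hc|hS1].
  have [_ surj _] := comaximal_split hR hS RS (erefl B) hc.
  by apply: hull_generates_of_complement; apply: surj.
exact: (comaximal_compositum hR hS RS hF (erefl B) hHi hull_cap hS1).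
Qed.

Lemma hull_generates_almost_prufer : S `<=` S' <-> almost_prufer R S.
Proof.
split=> [h|[T [hT pT Tint]]].
  exists H; split=> //; first by case: hH.
  move=> x /h; move: x; apply: compositum_min.
  - exact: integral_elements_subring.
  - by move=> x; exact: integral_over_id.
  - move=> x [_ [n [c [cR e]]]]; exists n, c; split=> // i; exact: RH.
apply/supp_hull_generates; apply/(comaximal_supp hR hS RS hF (erefl B)).
by apply: (comaximal_integral hR hS RS hF (erefl B) hT _ Tint); apply/(prufer_intclos hR hF (erefl B) hT).
Qed.

Let ivlS R1 : ivl R1 S' `<=` ivl R1 S.
Proof. by move=> T [hT [RT TS]]; split=> //; split=> //; exact: subset_trans S'S. Qed.

(** By finiteness [R1, S'] is all of [R1, S], so it contains S. *)
Let generates_of_ncard R1 : finite_set (ivl R1 S) -> R1 `<=` S ->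
  ncard (ivl R1 S) = ncard (ivl R1 S') -> S `<=` S'.
Proof.
move=> fin R1S e.
have : ivl R1 S S by split=> //; split.
by rewrite -(ncard_subset fin (@ivlS R1)) // => -[_ []].
Qed.

(** The isomorphisms always hold for R in S', so (8), (10) and (11) say that S and S' have equally
    many rings over R, B and H respectively. *)
Lemma hull_generates_ncard : FIP R S ->
  [/\ S `<=` S' <-> ncard (ivl R S) = (ncard (ivl R H) * ncard (ivl R B))%N,
      S `<=` S' <-> ncard (ivl R S) = (ncard (ivl R B) * ncard (ivl B S))%N,
      S `<=` S' <-> ncard (ivl R H) = ncard (ivl B S) &
      S `<=` S' <-> ncard (ivl R B) = ncard (ivl H S)].
Proof.
move=> fin.
have finite_ivl R1 S1 : R `<=` R1 -> S1 `<=` S -> finite_set (ivl R1 S1).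
  move=> RR1 S1S; apply: sub_finite_set fin => T [hT [RT TS]].
  by split=> //; split; [exact: subset_trans RT | exact: subset_trans S1S].
have fRH : finite_set (ivl R H) by exact: finite_ivl.
have fRB : finite_set (ivl R B) by exact: finite_ivl.
have fBS : finite_set (ivl B S) by exact: finite_ivl.
have fHS : finite_set (ivl H S) by exact: finite_ivl.
have n7 : ncard (ivl R S') = (ncard (ivl R H) * ncard (ivl R B))%N.
  rewrite -ncardX //; symmetry.
  apply: (ncard_order_iso _ _ _
    (complement_iso_prod hR hS' RS' hF' BE' hHi' hull_cap (fun=> id))).
  - exact: pair_le_anti.
  - by move=> T x.
  - exact: finite_setX.
have n5 : ncard (ivl R H) = ncard (ivl B S').
  apply: (ncard_order_iso _ _ fRH
    (complement_iso_upper hR hS' RS' hF' BE' hHi' hull_cap (fun=> id))).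
    exact: subset_anti.
  by move=> T x.
have n6 : ncard (ivl R B) = ncard (ivl H S').
  apply: (ncard_order_iso _ _ fRB
    (complement_iso_lower hR hS' RS' hF' BE' hHi' hull_cap (fun=> id))).
    exact: subset_anti.
  by move=> T x.
have eqS : S `<=` S' -> S' = S by move=> h; apply/seteqP.
split; split.
- by move=> /eqS e; rewrite -n7 e.
- by move=> e; apply: (@generates_of_ncard R) => //; rewrite n7.
- move=> h; rewrite -ncardX //.
  have hc := comaximal_compositum hR hS RS hF (erefl B) hHi hull_cap h.
  apply: (ncard_order_iso _ _ fin (comaximal_split hR hS RS (erefl B) hc)).
    exact: subset_anti.
  by move=> p; split.
(* The splitting map of [R, S] is always injective; equal cardinals make it onto, and it reaches (R,
   S). *)
- move=> e; apply: hull_generates_of_complement.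
  pose f := split_map B.
  have inj T T' : ivl R S T -> ivl R S T' -> f T = f T' -> T = T'.
    exact: split_map_inj.
  have im : f @` ivl R S = ivl R B `*` ivl B S.
    apply: ncard_subset; first exact: finite_setX.
      by move=> _ [T hT <-]; exact: (split_map_ivl hR hS RS (erefl B)).
    by rewrite ncard_image // ncardX.
  by move: ivl_RS; rewrite -im => -[T hT fT]; exists T.
- by move=> /eqS e; rewrite n5 e.
- by move=> e; apply: (@generates_of_ncard B) => //; rewrite -n5.
- by move=> /eqS e; rewrite n6 e.
- by move=> e; apply: (@generates_of_ncard H) => //; rewrite -n6.
Qed.

End Main.

(** * The zero ring, and the assembly of the equivalences *)

Lemma order_iso_set1 (X Y : Type) (x : X) (y : Y) leX leY (f : X -> Y) :
  leX x x -> leY y y -> f x = y -> order_iso [set x] [set y] leX leY f.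
Proof.
move=> lx ly fx; split.
- by move=> _ ->.
- by move=> _ ->; exists x.
- by move=> _ _ -> ->; rewrite fx.
Qed.

Theorem theorem7p6 (A : comPzRingType) (R S Rt : set A) :
  subring R -> subring S -> R `<=` S -> FCP R S ->
  prufer_hull R S Rt ->
  let Rb := intclos R S in
  let c1 := Supp R Rb R `&` Supp R S Rb = set0 in
  let c2 := order_iso (ivl R S) (ivl R Rb `*` ivl Rb S)
              subset (@pair_le A)
              (fun T => (T `&` Rb, compositum T Rb)) in
  let c3 := almost_prufer R S in
  let c4 := Supp R S Rb = Supp R Rt R in
  let c5 := order_iso (ivl R Rt) (ivl Rb S) subset subset
              (fun T => compositum T Rb) in
  let c6 := order_iso (ivl R Rb) (ivl Rt S) subset subset
              (fun T => compositum T Rt) in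
  let c7 := order_iso (ivl R Rt `*` ivl R Rb) (ivl R S)
              (@pair_le A) subset
              (fun p => compositum p.1 p.2) in
  let c8 := ncard (ivl R S) = (ncard (ivl R Rt) * ncard (ivl R Rb))%N in
  let c9 := ncard (ivl R S) = (ncard (ivl R Rb) * ncard (ivl Rb S))%N in
  let c10 := ncard (ivl R Rt) = ncard (ivl Rb S) in
  let c11 := ncard (ivl R Rb) = ncard (ivl Rt S) in
  [/\ (c1 <-> c2), (c1 <-> c3), (c1 <-> c4), (c1 <-> c5) & (c1 <-> c6)] /\
  (c1 <-> c7) /\
  (c1 -> Supp R S Rt = Supp R Rb R) /\
  (FIP R S -> [/\ c1 <-> c8, c1 <-> c9, c1 <-> c10 & c1 <-> c11]).
Proof.
move=> hR hS RS hF hH.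
(* In the zero ring every interval is a singleton, there are no primes, and the relation of degree
   0, which reads 1 = 0, makes every element integral. *)
have [A0|/comNzRing_of_comPzRing[A' eA]] := pselect ((1 : A) = 0).
  have subT (T : set A) : subring T -> T = setT.
    move=> hT; apply/seteqP; split=> // x _; rewrite -[x]mulr1 A0 mulr0.
    exact: subring0.
  have hHi : ivl R S Rt by case: hH.
  have eR := subT _ hR; have eS := subT _ hS; have eRt := subT _ hHi.1.
  move=> Rb; have eRb : Rb = setT.
    apply/seteqP; split=> // x _; split; first by rewrite eS.
    by exists 0%N, (fun=> 0); split; [case|rewrite big_ord0 expr0 A0 addr0].
  have hT : subring (setT : set A) by [].
  have eI : ivl setT setT = [set (setT : set A)].
    apply/seteqP; split=> [T [_ [h _]]|_ ->]; last by [].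
    by apply/seteqP; split.
  have eC (T U : set A) : compositum T U = setT by apply/subT/compositum_subring.
  have eP : ivl setT setT `*` ivl setT setT = [set ((setT : set A), (setT : set A))].
    by rewrite eI; apply/seteqP; split=> [[? ?] [/= -> ->]|_ ->].
  have eSupp (E B0 : set A) : Supp R E B0 = set0.
    rewrite -subset0 => P [[[_ P0 _ _] [P1 _]] _].
    by apply: P1; rewrite A0.
  have n1 : ncard [set (setT : set A)] = 1%N by rewrite /ncard fset_set1 cardfs1.
  have ap : almost_prufer R S.
    exists Rt; split=> //; first by case: hH.
    by move=> x _; exists 0%N, (fun=> 0); split; [case|rewrite big_ord0 expr0 A0 addr0].
  move=> c1 c2 c3 c4 c5 c6 c7 c8 c9 c10 c11.
  have h1 : c1 by rewrite /c1 !eSupp setI0.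
  have h4 : c4 by rewrite /c4 !eSupp.
  have h2 : c2.
    rewrite /c2 eRb eR eS eP eI; apply: order_iso_set1 => //.
    by rewrite setIT eC.
  have h5 : c5 by rewrite /c5 eRb eR eS eRt eI; apply: order_iso_set1.
  have h6 : c6 by rewrite /c6 eRb eR eS eRt eI; apply: order_iso_set1.
  have h7 : c7 by rewrite /c7 eRb eR eS eRt eP eI; apply: order_iso_set1 => //=.
  split; first by split.
  split; first by [].
  split; first by rewrite !eSupp.
  move=> _; have [h8 h9 h10 h11] : [/\ c8, c9, c10 & c11].
    by rewrite /c8 /c9 /c10 /c11 eRb eR eS eRt eI n1.
  by split.
subst A; move=> Rb c1 c2 c3 c4 c5 c6 c7 c8 c9 c10 c11.
have hHi : ivl R S Rt by case: hH.
have cap := hull_cap hR hF hH.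
have c1P : c1 <-> S `<=` compositum Rt Rb by exact: supp_hull_generates.
(* For (5), (6) and (7): a preimage of S presents S as a compositum of subrings of [Rt] and [Rb]. *)
have sub_gen (T U : set A') : T `<=` Rt -> U `<=` Rb -> S `<=` compositum T U -> c1.
  by move=> TR UB h; apply/c1P; apply: subset_trans h _; exact: compositumS.
have RbS : Rb `<=` S by exact: (intclos_sub (erefl Rb)).
have RRb : R `<=` Rb by exact: (sub_intclos hR RS (erefl Rb)).
have hRb : subring Rb by exact: (intclos_subring hR hS (erefl Rb)).
split.
  split.
  - split=> [h|[_ surj _]].
      by apply: comaximal_split => //; exact/(comaximal_supp hR hS RS hF).
    apply/c1P; apply: hull_generates_of_complement => //; apply: surj.
    by split; split=> //; split.
  - by rewrite c1P; exact: hull_generates_almost_prufer.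
  - split=> [/c1P h|h4]; first exact: complement_supp_upper.
    (* Over S' the supports of Rb/R and S'/Rb are disjoint, and the latter is that of Rt/R, which
       (4) identifies with the support of S/Rb. *)
    pose S' := compositum Rt Rb.
    have hS' : subring S' by exact: compositum_subring.
    have [_ [RRt RtS]] := hHi.
    have BS' : Rb `<=` S' by exact: compositum_subr.
    have RS' : R `<=` S' by exact: subset_trans BS'.
    have S'S : S' `<=` S by exact: compositum_min.
    have hF' : FCP R S' by exact: FCP_sub hF.
    have BE : intclos R S' = Rb by exact: intclos_ivl.
    have hHi' : ivl R S' Rt by case: hHi => ? _; split=> //; split=> //; exact: compositum_subl.
    have hc := comaximal_compositum hR hS' RS' hF' BE hHi' cap (fun=> id).
    rewrite /c1 h4 -(complement_supp_upper hR hS' RS' hF' BE hHi' cap (fun=> id)).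
    exact/(comaximal_supp hR hS' RS' hF' BE).
  - split=> [/c1P h|[_ surj _]]; first exact: complement_iso_upper.
    have [|T [_ [_ TRt]] e] := surj S; first by split=> //; split.
    by apply: (@sub_gen T Rb) => //; rewrite e.
  - split=> [/c1P h|[_ surj _]]; first exact: complement_iso_lower.
    have [|T [_ [_ TRb]] e] := surj S; first by case: hHi => _ [_ ?]; split=> //; split.
    by apply: (@sub_gen Rt T) => //; rewrite compositumC e.
split.
  split=> [/c1P h|[_ surj _]]; first exact: complement_iso_prod.
  have [|[T U] [/= [_ [_ TRt]] [_ [_ URb]]] e] := surj S; first by split=> //; split.
  by apply: (@sub_gen T U) => //; rewrite e.
split; first by move=> /c1P h; exact: complement_supp_lower.
by move=> /(hull_generates_ncard hR hS RS hF hH)[h8 h9 h10 h11]; split; rewrite c1P.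
Qed.
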